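(* Let $d\ge 3$ and let $\mathbb{T}^d$ be the $d$-regular tree, whose bond percolation threshold is $p_c=\frac{1}{d-1}$. (i) For $\left((\mathbb{T}^d,\mathbf{C}_{\lambda_1},\mathbf{C}_{\lambda_2},p)\right)_{p\in[0,1]}$ with $0<\lambda_1<d-1\le\lambda_2$, $$p_c^*=\frac{\max\{\lambda_1,1\}}{d-1}=\max\{\lambda_1,1\}\,p_c.$$ (ii) If $0<\lambda_1\le 1<d-1<\lambda_2$, then the critical network $\left(\mathbb{T}^d,\mathbf{C}_{\lambda_1},\mathbf{C}_{\lambda_2},\frac{1}{d-1}\right)$ is recurrent almost surely.
   Context: $\mathbb{T}^d$ is the infinite tree $G=(V,E)$ in which every vertex has degree $d$, with a fixed root $o$. A network $(G,\mathbf{c})$ is a graph with a conductance function $\mathbf{c}:E\to[0,\infty)$; its random walk moves from $x$ to a neighbour $y$ with probability $\mathbf{c}(\{x,y\})/\sum_{e\ni x}\mathbf{c}(e)$. The network is recurrent (transient) if this random walk is recurrent (transient). For $\lambda>0$ and $e=\{x,y\}\in E$ let $|e|=\min\{\mathrm{dist}(x,o),\mathrm{dist}(y,o)\}$ (graph distance) and $\mathbf{C}_\lambda(e)=\lambda^{-|e|}$. Grand coupling: let $(U_e)_{e\in E}$ be i.i.d. uniform on $[0,1]$. For $p\in[0,1]$, edge $e$ is open in Bernoulli-$p$ bond percolation $\omega_p$ if $U_e\le p$ and closed otherwise. $p_c(G)$ is the critical probability for existence of an infinite open cluster. The disordered random network $(G,\mathbf{c}_1,\mathbf{c}_2,p)$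 is the random network on $G$ in which every open edge $e$ of $\omega_p$ has conductance $\mathbf{c}_1(e)$ and every closed edge $e$ has conductance $\mathbf{c}_2(e)$. The recurrence/transience threshold is $p_c^*=\sup\{p\in[0,1]:\ \text{almost surely, }(G,\mathbf{C}_{\lambda_1},\mathbf{C}_{\lambda_2},q)\text{ is recurrent for all }q\in[0,p)\}$. *)

(* Defs.v *)
From HB Require Import structures.
From mathcomp Require Import all_boot all_order all_algebra finmap.
From mathcomp Require Import all_classical all_reals all_analysis.

Set Implicit Arguments.
Unset Strict Implicit.
Unset Printing Implicit Defensive.

Import Order.TTheory GRing.Theory Num.Theory.

Local Open Scope classical_set_scope.
Local Open Scope ring_scope.
Local Open Scope card_scope.

(* A graph is a vertex type V with an adjacency relation. An edge is the
   two-element finite set of its endpoints; edge-indexed families are total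
   functions on {fset V} of which only the values on [edges adj] matter. *)

Definition edges (V : choiceType) (adj : rel V) : set {fset V} :=
  [set e | exists x y, adj x y /\ e = [fset x; y]%fset].

(* Only used on nonempty sets; the value on the empty set is 0. *)
Definition nat_min (A : set nat) : nat :=
  xget 0%N [set n | A n /\ forall m, A m -> (n <= m)%N].

Definition reachable (V : choiceType) (adj : rel V) (x y : V) : Prop :=
  exists2 p : seq V, path adj x p & last x p = y.

Definition gdist (V : choiceType) (adj : rel V) (x y : V) : nat :=
  nat_min [set n | exists p : seq V,
             [/\ path adj x p, last x p = y & size p = n]].

(* [ucycle adj [:: x; y]] holds as soon as x and y are adjacent, so genuine
   cycles are those with at least three vertices. *)
Definition is_tree (V : choiceType) (adj : rel V) : Prop :=
  [/\ symmetric adj, irreflexive adj,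
      forall x y, reachable adj x y
    & forall c : seq V, ucycle adj c -> (size c < 3)%N].

Definition is_regular_tree (d : nat) (V : choiceType) (adj : rel V) : Prop :=
  is_tree adj /\ forall x : V, [set y | adj x y] #= [set: 'I_d].

(* Random walk on the network with conductances c. *)

Definition trans_prob (R : realType) (V : choiceType) (adj : rel V)
    (c : {fset V} -> R) (x y : V) : R :=
  if adj x y then
    c [fset x; y]%fset / \sum_(e \in [set e | edges adj e /\ x \in e]) c e
  else 0.

(* X is the random walk started at x: its finite-dimensional distributions are
   P(X_0 = z_0, ..., X_n = z_n) = 1_{z_0 = x} \prod_(k < n) p(z_k, z_(k+1)). *)
Definition is_random_walk (R : realType) (V : choiceType) (adj : rel V)
    (c : {fset V} -> R) (x : V) (dT : measure_display) (T : measurableType dT)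
    (P : probability T R) (X : nat -> T -> V) : Prop :=
  (forall n y, measurable (X n @^-1` [set y])) /\
  forall (n : nat) (z : nat -> V),
    P [set t | forall k, (k <= n)%N -> X k t = z k] =
    ((z 0%N == x)%:R * \prod_(k < n) trans_prob adj c (z k) (z k.+1))%:E.

(* From every starting vertex, the walk almost surely returns to it. The walk
   is determined in law, so quantifying over all its realizations amounts to
   considering any one of them. *)
Definition recurrent (R : realType) (V : choiceType) (adj : rel V)
    (c : {fset V} -> R) : Prop :=
  forall (x : V) (dT : measure_display) (T : measurableType dT)
    (P : probability T R) (X : nat -> T -> V),
    is_random_walk adj c x P X ->
    {ae P, forall t, exists n, (0 < n)%N /\ X n t = x}.

Definition edge_level (V : choiceType) (adj : rel V) (o : V)
    (e : {fset V}) : nat :=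
  nat_min [set n | exists2 x, x \in e & gdist adj x o = n].

Definition Clambda (R : realType) (V : choiceType) (adj : rel V) (o : V)
    (lambda : R) (e : {fset V}) : R :=
  lambda ^- edge_level adj o e.

(* Grand coupling: (U e), e an edge, are mutually independent and uniform on
   [0, 1]. *)
Definition iid_uniform (R : realType) (V : choiceType) (adj : rel V)
    (dW : measure_display) (W : measurableType dW) (P : probability W R)
    (U : {fset V} -> {RV P >-> R}) : Prop :=
  (forall e (A : set R), edges adj e -> measurable A ->
     distribution P (U e) A = uniform_prob (@ltr01 R) A) /\
  forall (s : {fset {fset V}}) (A : {fset V} -> set R),
    (forall e, e \in s -> edges adj e) ->
    (forall e, e \in s -> measurable (A e)) ->
    P [set w | forall e, e \in s -> A e (U e w)] =
    (\prod_(e <- s) P (U e @^-1` A e))%E.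

Section percolation.
Context (R : realType) (V : choiceType) (adj : rel V).
Context (dW : measure_display) (W : measurableType dW) (P : probability W R).
Context (U : {fset V} -> {RV P >-> R}).

Definition open_adj (p : R) (w : W) : rel V :=
  [rel x y | adj x y && (U [fset x; y]%fset w <= p)].

Definition has_infinite_cluster (p : R) (w : W) : Prop :=
  exists x, infinite_set [set y | reachable (open_adj p w) x y].

Definition p_c : R :=
  sup [set p | 0 <= p <= 1 /\ {ae P, forall w, ~ has_infinite_cluster p w}].

Definition disordered (c1 c2 : {fset V} -> R) (p : R) (w : W)
    (e : {fset V}) : R :=
  if U e w <= p then c1 e else c2 e.

Definition p_c_star (c1 c2 : {fset V} -> R) : R :=
  sup [set p | 0 <= p <= 1 /\
    {ae P, forall w, forall q, 0 <= q < p ->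
       recurrent adj (disordered c1 c2 q w)}].

End percolation.

(* Main.v *)
Require Import Defs.
From HB Require Import structures.
From mathcomp Require Import all_boot all_order all_algebra finmap.
From mathcomp Require Import all_classical all_reals all_analysis.
From mathcomp Require Import ring lra zify.

Set Implicit Arguments.
Unset Strict Implicit.
Unset Printing Implicit Defensive.

Import Order.TTheory GRing.Theory Num.Theory.
Import numFieldNormedType.Exports.

Local Open Scope classical_set_scope.
Local Open Scope ring_scope.

(** Let b = d - 1 and index every edge by its endpoint i farther from the root,
so that the open edges form a family of independent bits O. Everything is
decided by branching quantities, defined by recursion from a vertex down to its
children.

Recurrence. The unit flow that splits evenly at every vertex gives about b^-k to
an edge at level k. A closed edge at level k has conductance at most b^-k, so
the closed edges of any cutset have bounded total conductance. Stop every open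
path that starts at level m at its first closed edge, or after L open steps:
this is a cutset, and it has bounded conductance as soon as the open paths of
length L below level m have small total weight, where such a path weighs
l1^-L ([thin_below], [energy_top]). Averaging K such cutoffs over disjoint
ranges of levels gives compactly supported test functions of energy O(1/K), as
in the Nash-Williams criterion ([cutoff_average]). By a Caccioppoli inequality a
bounded function that vanishes at x and is harmonic elsewhere is then zero
([liouville]); the probability of never hitting x is such a function
([recurrent_of_cutoffs]). Since the weight of open paths increases with the set
of open edges, one almost sure event serves all smaller parameters at once. The
expected weight is (b p / l1)^L up to a constant, which settles b p < l1
([ae_thin]). At p = 1/b the critical branching process dies out, so below every
level there are no long open paths at all, whatever l1 is ([ae_extinct]).

Transience. Let max(l1, 1) < lam < b p. The probability [survival lam n v] that v
is joined to depth n, when every open edge is kept with the further probability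
1/lam, has as its mean the survival probability of a branching process with mean
offspring b p / lam > 1, hence is bounded below ([supercritical_iter]); so its
limit in n is positive at the root with positive probability ([survive_prob]).
By the union bound this limit satisfies
s v <= sum over open children i of s i / lam, and s <= 1 turns this into
A v <= sum over open children i of A i / (l1 + A i) for A = (lam - l1) s. This
is the series-parallel recursion of effective conductances with an inequality,
and the voltage associated with A gives a function with values in [0, 1] that
vanishes at the root and is subharmonic elsewhere ([escape_subharmonic]): the
walk may escape ([not_recurrent_of_subharmonic]). A random walk to which this
applies is built from the uniform variables of the edges of one ray, which are
independent ([walk_is_random_walk]).

With lam = 1, [survival] is the indicator of an open path of length n, so the same
two estimates give p_c = 1/b, and [ae_extinct] contains the critical case. *)

(** * Rooted trees *)

(** The combinatorics of a tree rooted at o in which every vertex has b children,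
and the root one more: [lv] is the distance to the root, and [par o] is an
arbitrary value. *)
Record rtree (V : choiceType) (o : V) (b : nat) := RTree {
  lv : V -> nat;
  par : V -> V;
  ch : V -> seq V;
  ch_uniq : forall v, uniq (ch v);
  mem_ch : forall v i, (i \in ch v) = (i != o) && (par i == v);
  lv_root : lv o = 0%N;
  lv_par : forall i, i != o -> lv i = (lv (par i)).+1;
  size_ch : forall v, size (ch v) = ((v == o) + b)%N }.

(** Blocks are disjoint because the key k tells which block an element lies in. *)
Lemma uniq_flatten_key (I J : eqType) (k : J -> I) (f : I -> seq J) (l : seq I) :
  uniq l -> (forall i, i \in l -> uniq (f i)) ->
  (forall i x, i \in l -> x \in f i -> k x = i) ->
  uniq (flatten [seq f i | i <- l]).
Proof.
elim: l => //= i l IH /andP[il ul] uf kf.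
rewrite cat_uniq uf ?mem_head//= IH//; last 2 first.
- by move=> j jl; apply: uf; rewrite inE jl orbT.
- by move=> j x jl; apply: kf; rewrite inE jl orbT.
rewrite andbT; apply/hasPn => x /flatten_mapP[j jl xj].
apply/negP => xi; move: il; rewrite -(kf i x) ?mem_head//.
by rewrite (kf j x) ?jl// inE jl orbT.
Qed.

Section Tree.
Context (V : choiceType) (o : V) (b : nat) (T : rtree o b).
Local Notation lv := (lv T).
Local Notation par := (par T).
Local Notation ch := (ch T).

Lemma chP v i : i \in ch v -> [/\ i != o, par i = v & lv i = (lv v).+1].
Proof.
by rewrite mem_ch => /andP[io /eqP pi]; rewrite lv_par// pi.
Qed.

(** The strict descendants of v down to relative depth n; each stands for the edge
to its parent, so this lists the edges on which a depth-n recursion depends. *)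
Fixpoint desc n v : seq V :=
  if n is n'.+1 then flatten [seq i :: desc n' i | i <- ch v] else [::].

(** The ancestor at level [lv v] determines the block, which is what makes the
families of descendants of two siblings disjoint. *)
Lemma descP n v i : i \in desc n v ->
  [/\ i != o, (lv v < lv i)%N & iter (lv i - lv v) par i = v].
Proof.
elim: n v => //= n IH v /flatten_mapP[j jv].
have [jo pj lj] := chP jv.
rewrite inE => /orP[/eqP ->|/IH[io ij it]]; split=> //; first by lia.
- by rewrite lj subSnn /= pj.
- lia.
- by rewrite (_ : lv i - lv v = (lv i - lv j).+1)%N ?iterS ?it//; lia.
Qed.

Lemma desc_uniq n v : uniq (desc n v).
Proof.
elim: n v => //= n IH v.
apply: (@uniq_flatten_key _ _ (fun x => iter (lv x - (lv v).+1) par x)).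
- exact: ch_uniq.
- move=> i iv /=; rewrite IH andbT; apply/negP => /descP[_]; lia.
- move=> i x iv; have [io pi li] := chP iv.
  rewrite inE => /orP[/eqP ->|/descP[xo ix it]]; first by rewrite li subnn.
  by rewrite -li.
Qed.

Lemma desc_nroot n v : o \notin desc n v.
Proof. by apply/negP => /descP[]; rewrite eqxx. Qed.

End Tree.

(** * Independent bits *)

Section Bits.
Context (R : realType) (V : choiceType) (p : R).
Implicit Types (s t : seq V) (O : V -> bool) (F G : (V -> bool) -> R).

Definition depends s (X : Type) (F : (V -> bool) -> X) :=
  forall O O', {in s, O =1 O'} -> F O = F O'.

Definition set_bit O i c := fun j => if j == i then c else O j.

(** Expectation of F over bits that are true with probability p independently on s
and false elsewhere. Working with this finite sum keeps integration theory out
of the branching estimates; [pr_bits] relates it to the probability space. *)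
Fixpoint bit_expect s F : R :=
  if s is i :: s' then
    p * bit_expect s' (fun O => F (set_bit O i true)) +
    (1 - p) * bit_expect s' (fun O => F (set_bit O i false))
  else F (fun=> false).

Lemma eq_bit_expect s F G : F =1 G -> bit_expect s F = bit_expect s G.
Proof. by move=> /funext ->. Qed.

Lemma bit_expect_cst s (c : R) : bit_expect s (fun=> c) = c.
Proof. by elim: s => //= i s ->; ring. Qed.

Lemma bit_expectD s F G :
  bit_expect s (fun O => F O + G O) = bit_expect s F + bit_expect s G.
Proof. by elim: s F G => //= i s IH F G; rewrite !IH; ring. Qed.

Lemma bit_expectZ s (c : R) F : bit_expect s (fun O => c * F O) = c * bit_expect s F.
Proof. by elim: s F => //= i s IH F; rewrite !IH; ring. Qed.

Lemma bit_expect_le s F G : 0 <= p <= 1 -> (forall O, F O <= G O) ->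
  bit_expect s F <= bit_expect s G.
Proof.
move=> /andP[p0 p1]; elim: s F G => //= i s IH F G FG.
by rewrite lerD// ler_wpM2l ?subr_ge0// IH.
Qed.

Lemma depends_sub s t (X : Type) (F : (V -> bool) -> X) :
  {subset s <= t} -> depends s F -> depends t F.
Proof. by move=> st dF O O' OO'; apply: dF => i /st; exact: OO'. Qed.

Lemma depends_set_bit i s (X : Type) (F : (V -> bool) -> X) c :
  depends (i :: s) F -> depends s (fun O => F (set_bit O i c)).
Proof.
move=> dF O O' OO'; apply: dF => j; rewrite /set_bit inE.
by case: eqP => //= _ /OO'.
Qed.

Lemma depends_set_bit_id i s (X : Type) (F : (V -> bool) -> X) c :
  i \notin s -> depends s F -> (fun O => F (set_bit O i c)) = F.
Proof.
move=> si dF; apply/funext => O; apply: dF => j js; rewrite /set_bit.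
by case: eqP => // ji; move: si; rewrite -ji js.
Qed.

Lemma bit_expect_skip i s F : i \notin s -> depends s F ->
  bit_expect (i :: s) F = bit_expect s F.
Proof. by move=> si dF /=; rewrite !(depends_set_bit_id _ si dF); ring. Qed.

(** Independence of functions of disjoint sets of bits. *)
Lemma bit_expect_catM s t F G : uniq (s ++ t) -> depends s F -> depends t G ->
  bit_expect (s ++ t) (fun O => F O * G O) = bit_expect s F * bit_expect t G.
Proof.
elim: s F => [|i s IH] F /=.
  move=> _ dF _; rewrite -bit_expectZ; apply: eq_bit_expect => O; congr (_ * _); exact: dF.
rewrite mem_cat negb_or => /andP[/andP[is_ it] u] dF dG.
have e c : bit_expect (s ++ t) (fun O => F (set_bit O i c) * G (set_bit O i c)) =
           bit_expect s (fun O => F (set_bit O i c)) * bit_expect t G.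
  rewrite -IH//; last exact: depends_set_bit.
  apply: eq_bit_expect => O; congr (_ * _).
  exact: (congr1 (@^~ O) (depends_set_bit_id c it dG)).
by rewrite !e; ring.
Qed.

Lemma bit_expect_catl s t F : uniq (s ++ t) -> depends s F ->
  bit_expect (s ++ t) F = bit_expect s F.
Proof.
move=> u dF; rewrite -[RHS]mulr1 -(bit_expect_cst t 1) -bit_expect_catM//.
by apply: eq_bit_expect => O; rewrite mulr1.
Qed.

Lemma bit_expect_catr s t F : uniq (s ++ t) -> depends t F ->
  bit_expect (s ++ t) F = bit_expect t F.
Proof.
move=> u dF; rewrite -[RHS]mul1r -(bit_expect_cst s 1) -bit_expect_catM//.
by apply: eq_bit_expect => O; rewrite mul1r.
Qed.

Lemma bit_expect_flattenM (I : eqType) (l : seq I) (D : I -> seq V)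
    (F : I -> (V -> bool) -> R) :
  uniq (flatten [seq D i | i <- l]) -> (forall i, i \in l -> depends (D i) (F i)) ->
  bit_expect (flatten [seq D i | i <- l]) (fun O => \prod_(i <- l) F i O) =
  \prod_(i <- l) bit_expect (D i) (F i).
Proof.
elim: l => [|i l IH] /= u dF; first by rewrite !big_nil.
rewrite big_cons -IH; last 2 first.
- by move: u; rewrite cat_uniq => /and3P[].
- by move=> j jl; apply: dF; rewrite inE jl orbT.
rewrite -bit_expect_catM//; last 2 first.
- by apply: dF; rewrite mem_head.
- move=> O O' OO'; apply: eq_big_seq => j jl.
  apply: dF; first by rewrite inE jl orbT.
  by move=> x xj; apply: OO'; apply/flatten_mapP; exists j.
by apply: eq_bit_expect => O; rewrite big_cons.
Qed.

Lemma bit_expect_flattenD (I : eqType) (l : seq I) (D : I -> seq V)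
    (F : I -> (V -> bool) -> R) :
  uniq (flatten [seq D i | i <- l]) -> (forall i, i \in l -> depends (D i) (F i)) ->
  bit_expect (flatten [seq D i | i <- l]) (fun O => \sum_(i <- l) F i O) =
  \sum_(i <- l) bit_expect (D i) (F i).
Proof.
elim: l => [|i l IH] /= u dF; first by rewrite !big_nil.
have u' : uniq (flatten [seq D i | i <- l]).
  by move: u; rewrite cat_uniq => /and3P[].
rewrite big_cons -IH//; last by move=> j jl; apply: dF; rewrite inE jl orbT.
rewrite -(@bit_expect_catl _ _ (F i) u); last by apply: dF; rewrite mem_head.
rewrite -(@bit_expect_catr (D i) _ (fun O => \sum_(j <- l) F j O) u); last first.
  move=> O O' OO'; apply: eq_big_seq => j jl.
  apply: dF; first by rewrite inE jl orbT.
  by move=> x xj; apply: OO'; apply/flatten_mapP; exists j.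
by rewrite -bit_expectD; apply: eq_bit_expect => O; rewrite big_cons.
Qed.

End Bits.

(** * Branching recursions on the tree *)

Section Survival.
Context (R : realType) (V : choiceType) (o : V) (b : nat) (T : rtree o b).
Local Notation lv := (lv T).
Local Notation par := (par T).
Local Notation ch := (ch T).
Local Notation desc := (desc T).
Implicit Types (O : V -> bool) (lam : R).

(** The probability that v is joined to depth n by the open edges when each of them
is kept with the further probability 1 / lam. *)
Fixpoint survival lam n v O : R :=
  if n is n'.+1 then 1 - \prod_(i <- ch v) (1 - (O i)%:R * survival lam n' i O / lam)
  else 1.

(** The sum of lam^-n over the open paths of length n that go down from v. *)
Fixpoint path_weight lam n v O : R :=
  if n is n'.+1 then \sum_(i <- ch v) (O i)%:R * path_weight lam n' i O / lam else 1.

Fixpoint level_sum (F : V -> (V -> bool) -> R) j v O : R :=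
  if j is j'.+1 then \sum_(i <- ch v) level_sum F j' i O else F v O.

Lemma in_desc_self n v i : i \in ch v -> i \in desc n.+1 v.
Proof. by move=> iv; apply/flatten_mapP; exists i; rewrite ?mem_head. Qed.

Lemma in_desc_sub n v i x : i \in ch v -> x \in desc n i -> x \in desc n.+1 v.
Proof. by move=> iv xi; apply/flatten_mapP; exists i; rewrite // inE xi orbT. Qed.

Lemma depends_survival lam n v : depends (desc n v) (survival lam n v).
Proof.
elim: n v => [|n IH] v O O' OO' //; rewrite /survival -/(survival lam).
congr (1 - _); apply: eq_big_seq => i iv.
by rewrite OO' ?in_desc_self// (IH i O O')// => x xi; rewrite OO'// (in_desc_sub iv).
Qed.

Lemma depends_path_weight lam n v : depends (desc n v) (path_weight lam n v).
Proof.
elim: n v => [|n IH] v O O' OO' //; rewrite /path_weight -/(path_weight lam).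
apply: eq_big_seq => i iv.
by rewrite OO' ?in_desc_self// (IH i O O')// => x xi; rewrite OO'// (in_desc_sub iv).
Qed.

Lemma depends_level_sum F n j v : (forall i, depends (desc n i) (F i)) ->
  depends (desc (j + n) v) (level_sum F j v).
Proof.
move=> dF; elim: j v => [|j IH] v O O' OO'; first exact: (dF v).
rewrite /level_sum -/(level_sum F); apply: eq_big_seq => i iv.
by apply: IH => x xi; rewrite OO'// addSn (in_desc_sub iv).
Qed.

(** One step of survival: b children, each reached with probability r and then
surviving with probability t. *)
Definition survival_map (r : R) t := 1 - (1 - r * t) ^+ b.

Section Expectation.
Variable p : R.

Lemma bit_expect_head i n (F : (V -> bool) -> R) : depends (desc n i) F ->
  bit_expect p (i :: desc n i) (fun O => (O i)%:R * F O) = p * bit_expect p (desc n i) F.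
Proof.
move=> dF; have ni : i \notin desc n i by apply/negP => /descP[_]; rewrite ltnn.
rewrite /= /set_bit eqxx /=.
rewrite (eq_bit_expect _ _ (G := F)); last first.
  by move=> O; rewrite mul1r; exact: (congr1 (@^~ O) (depends_set_bit_id true ni dF)).
rewrite [X in _ + _ * X](eq_bit_expect _ _ (G := fun=> 0)) ?bit_expect_cst; first by ring.
by move=> O; rewrite mul0r.
Qed.

Lemma depends_head i n (F : (V -> bool) -> R) : depends (desc n i) F ->
  depends (i :: desc n i) (fun O => (O i)%:R * F O).
Proof.
move=> dF O O' OO'; rewrite OO' ?mem_head//; congr (_ * _); apply: dF => x xi.
by rewrite OO'// inE xi orbT.
Qed.

(** The children have disjoint sets of descendants, so the product in the
recursion factorizes under the expectation. *)
Lemma bit_expect_survival_step lam n v t :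
  (forall i, i \in ch v -> bit_expect p (desc n i) (survival lam n i) = t) ->
  bit_expect p (desc n.+1 v) (survival lam n.+1 v) = 1 - (1 - p / lam * t) ^+ ((v == o) + b).
Proof.
move=> Et.
rewrite (eq_bit_expect _ _ (G := fun O => 1 + (- 1) *
   \prod_(i <- ch v) (1 + (- lam^-1) * ((O i)%:R * survival lam n i O)))); last first.
  move=> O; rewrite mulN1r; congr (1 - _); apply: eq_bigr => i _.
  by rewrite mulNr [lam^-1 * _]mulrC.
rewrite bit_expectD bit_expect_cst bit_expectZ mulN1r; congr (1 - _).
rewrite (@bit_expect_flattenM _ _ p _ (ch v) (fun i => i :: desc n i)
  (fun i O => 1 + (- lam^-1) * ((O i)%:R * survival lam n i O))); last 2 first.
- exact: (@desc_uniq _ _ _ T n.+1 v).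
- move=> i iv O O' OO'; congr (_ + _ * _).
  exact: (depends_head (@depends_survival lam n i) OO').
rewrite (eq_big_seq (fun=> 1 - p / lam * t)); last first.
  move=> i iv; rewrite bit_expectD bit_expect_cst bit_expectZ bit_expect_head; last exact: depends_survival.
  by rewrite Et//; ring.
by rewrite big_const_seq count_predT iter_mulr_1 size_ch.
Qed.

Lemma bit_expect_survival lam n v : v != o ->
  bit_expect p (desc n v) (survival lam n v) = iter n (survival_map (p / lam)) 1.
Proof.
elim: n v => [|n IH] v vo; first by rewrite /= .
rewrite (@bit_expect_survival_step lam n v (iter n (survival_map (p / lam)) 1)).
  by rewrite (negbTE vo) iterS.
by move=> i /chP[io _ _]; exact: IH.
Qed.

Lemma bit_expect_path_weight lam n v : v != o ->
  bit_expect p (desc n v) (path_weight lam n v) = (b%:R * (p / lam)) ^+ n.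
Proof.
elim: n v => [|n IH] v vo; first by rewrite /= expr0.
rewrite (eq_bit_expect _ _ (G := fun O =>
   \sum_(i <- ch v) lam^-1 * ((O i)%:R * path_weight lam n i O))); last first.
  by move=> O; apply: eq_bigr => i _; rewrite [RHS]mulrC.
rewrite (@bit_expect_flattenD _ _ p _ (ch v) (fun i => i :: desc n i)
  (fun i O => lam^-1 * ((O i)%:R * path_weight lam n i O))); last 2 first.
- exact: (@desc_uniq _ _ _ T n.+1 v).
- move=> i iv O O' OO'; congr (_ * _).
  exact: (depends_head (@depends_path_weight lam n i) OO').
rewrite (eq_big_seq (fun=> (p / lam) * (b%:R * (p / lam)) ^+ n)); last first.
  move=> i /chP[io _ _]; rewrite bit_expectZ bit_expect_head; last exact: depends_path_weight.
  by rewrite IH//; ring.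
rewrite big_const_seq count_predT iter_addr_0 size_ch (negbTE vo) add0n exprS.
by rewrite -mulr_natl; ring.
Qed.

Lemma bit_expect_level_sum F n j v (t : R) : (0 < j)%N || (v != o) -> 0 <= t ->
  (forall i, depends (desc n i) (F i)) ->
  (forall i, i != o -> bit_expect p (desc n i) (F i) = t) ->
  bit_expect p (desc (j + n) v) (level_sum F j v) <= b.+1%:R ^+ j * t.
Proof.
move=> jv t0 dF Et; elim: j v jv => [|j IH] v jv.
  by rewrite add0n /= expr0 mul1r Et.
rewrite (eq_bit_expect _ _ (G := fun O => \sum_(i <- ch v) level_sum F j i O))//.
have dl i : depends (desc (j + n) i) (level_sum F j i) by exact: depends_level_sum.
rewrite addSn (@bit_expect_flattenD _ _ p _ (ch v) (fun i => i :: desc (j + n) i)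
  (fun i O => level_sum F j i O)); last 2 first.
- exact: (@desc_uniq _ _ _ T (j + n).+1 v).
- by move=> i iv; apply: depends_sub (dl i) => x xi; rewrite inE xi orbT.
apply: le_trans (_ : \sum_(i <- ch v) (b.+1%:R ^+ j * t) <= _).
  rewrite big_seq [leRHS]big_seq; apply: ler_sum => i iv.
  rewrite bit_expect_skip//; last first.
    by apply/negP => /descP[_]; rewrite ltnn.
  by apply: IH; have [-> _ _] := chP iv; rewrite orbT.
rewrite big_const_seq count_predT iter_addr_0 size_ch exprS.
rewrite -[leLHS]mulr_natl -mulrA ler_wpM2r ?mulr_ge0 ?exprn_ge0// ler_nat.
by case: (v == o).
Qed.

End Expectation.

Lemma factor_itv (c : bool) (s lam : R) : 1 <= lam -> 0 <= s <= 1 ->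
  0 <= 1 - c%:R * s / lam <= 1.
Proof.
move=> l1 /andP[s0 s1]; have l0 : 0 < lam by lra.
case: c; rewrite ?mul1r ?mul0r ?subr0 ?ler01 ?lexx//.
rewrite subr_ge0 ler_pdivrMr// mul1r (le_trans s1)//=.
by rewrite lerBlDr lerDl divr_ge0// ltW.
Qed.

Lemma survival_itv lam n v O : 1 <= lam -> 0 <= survival lam n v O <= 1.
Proof.
move=> l1; elim: n v => [|n IH] v; first by rewrite /= ler01 lexx.
have H i : 0 <= 1 - (O i)%:R * survival lam n i O / lam <= 1 by exact: factor_itv.
rewrite /= subr_ge0; apply/andP; split.
  by apply: Num.Theory.prodr_ile1 => i _.
by rewrite lerBlDr lerDl prodr_ge0// => i _; have /andP[] := H i.
Qed.

Lemma survivalS_le lam n v O : 1 <= lam ->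
  survival lam n.+1 v O <= survival lam n v O.
Proof.
move=> l1; elim: n v => [|n IH] v.
  by have /andP[] := @survival_itv lam 1 v O l1.
have l0 : 0 < lam by lra.
rewrite /survival -/(survival lam n.+1) -/(survival lam n) lerB// ler_prod// => i _.
have /andP[-> _] := factor_itv (O i) l1 (@survival_itv lam n i O l1).
by rewrite lerB// ler_wpM2r ?invr_ge0 ?(ltW l0)// ler_wpM2l// IH.
Qed.

Lemma survival_anti lam m n v O : 1 <= lam -> (m <= n)%N ->
  survival lam n v O <= survival lam m v O.
Proof.
move=> l1 mn; rewrite -(subnK mn); elim: (n - m)%N => // k IH.
by rewrite addSn; apply: le_trans IH; exact: survivalS_le.
Qed.

(** The union bound. *)
Lemma survival_le_sum lam n v O : 1 <= lam ->
  survival lam n.+1 v O <= \sum_(i <- ch v) (O i)%:R * survival lam n i O / lam.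
Proof.
move=> l1; have l0 : 0 < lam by lra.
rewrite /survival -/(survival lam); elim: (ch v) => [|i l IH].
  by rewrite !big_nil subrr.
rewrite !big_cons.
have /andP[_] := factor_itv (O i) l1 (@survival_itv lam n i O l1).
set x := (O i)%:R * _ / lam => x0.
have : \prod_(j <- l) (1 - (O j)%:R * survival lam n j O / lam) <= 1.
  apply: Num.Theory.prodr_ile1 => j _; exact: factor_itv (survival_itv _ _ _ l1).
by move: IH; nra.
Qed.

Lemma path_weight_ge0 lam n v O : 0 <= lam -> 0 <= path_weight lam n v O.
Proof.
move=> l0; elim: n v => //= n IH v.
by apply: sumr_ge0 => i _; rewrite divr_ge0// mulr_ge0.
Qed.

Lemma path_weight_mono lam n v O O' : 0 <= lam -> (forall i, O i -> O' i) ->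
  path_weight lam n v O <= path_weight lam n v O'.
Proof.
move=> l0 OO'; elim: n v => //= n IH v; apply: ler_sum => i _.
rewrite ler_wpM2r ?invr_ge0//; apply: ler_pM => //; first exact: path_weight_ge0.
by rewrite ler_nat; case: (O i) (OO' i) => // ->.
Qed.

(** For lam = 1 nothing is random beyond O: survival is an indicator. *)
Lemma survival1_bool n v O : survival 1 n v O = 0 \/ survival 1 n v O = 1.
Proof.
elim: n v => /= [|n IH] v; first by right.
have [H|H] : \prod_(i <- ch v) (1 - (O i)%:R * survival 1 n i O / 1) = 0 \/
  \prod_(i <- ch v) (1 - (O i)%:R * survival 1 n i O / 1) = 1.
  elim: (ch v) => [|i l [IHl|IHl]]; rewrite ?big_nil ?big_cons ?IHl; first by right.
    by left; rewrite mulr0.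
  rewrite divr1 mulr1; case: (O i); rewrite ?mul1r ?mul0r ?subr0; last by right.
  by case: (IH i) => ->; rewrite ?subr0 ?subrr; [right|left].
- by right; rewrite H subr0.
- by left; rewrite H subrr.
Qed.

Lemma survival1_eq0 n v O : survival 1 n.+1 v O = 0 ->
  forall i, i \in ch v -> O i -> survival 1 n i O = 0.
Proof.
move=> + i iv Oi; rewrite /survival -/(survival 1) => /eqP.
rewrite subr_eq0 => /eqP H; case: (survival1_bool n i O) => // s1.
move: H; rewrite (big_rem i iv)/= Oi s1 divr1 mulr1 subrr mul0r => /eqP.
by rewrite oner_eq0.
Qed.

Lemma path_weight_survival1 lam n v O : survival 1 n v O = 0 ->
  path_weight lam n v O = 0.
Proof.
elim: n v => [|n IH] v; first by move=> /= /eqP; rewrite oner_eq0.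
move=> /survival1_eq0 H /=; rewrite big_seq big1// => i iv.
case: (boolP (O i)) => Oi; last by rewrite !mul0r.
by rewrite IH ?mulr0 ?mul0r// H.
Qed.

Lemma level_sum_ge0 F j v O : (forall i, 0 <= F i O) -> 0 <= level_sum F j v O.
Proof. by move=> F0; elim: j v => //= j IH v; apply: sumr_ge0. Qed.

(** Two configurations appear so that the lemma covers both monotonicity in F and
monotonicity in the set of open edges. *)
Lemma level_sum_le F G j v O O' : (forall i, F i O <= G i O') ->
  level_sum F j v O <= level_sum G j v O'.
Proof. by move=> FG; elim: j v => //= j IH v; apply: ler_sum => i _. Qed.

Lemma level_sum_ub F j v O i : (forall i, 0 <= F i O) ->
  (lv i = lv v + j)%N -> iter j par i = v -> F i O <= level_sum F j v O.
Proof.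
move=> F0; elim: j v => [|j IH] v; first by rewrite /= => _ ->.
move=> li pi /=.
have li1 : lv (iter j par i) = (lv v).+1.
  have io k : (k <= lv i)%N -> lv (iter k par i) = (lv i - k)%N.
    elim: k => [|k IHk] ki; first by rewrite subn0.
    rewrite iterS; have := IHk (ltnW ki) => lk.
    have ko : iter k par i != o.
      by apply/eqP => ko; move: lk; rewrite ko lv_root; lia.
    by move: (lv_par T ko); lia.
  by rewrite io li; lia.
have iv : iter j par i \in ch v.
  rewrite mem_ch -iterS pi eqxx andbT; apply/eqP => io.
  by move: li1; rewrite io lv_root.
rewrite (big_rem _ iv)/= (le_trans (IH (iter j par i) _ _))//.
  by rewrite li1 li; lia.
by rewrite lerDl sumr_ge0// => k _; exact: level_sum_ge0.
Qed.

End Survival.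

(** * The generating function of the branching process *)

Section SurvivalMap.
Context (R : realType) (b : nat).
Implicit Types r t x : R.

(** From (1 - x)(1 + (b + 1) x) <= 1 + b x, by induction on b. *)
Lemma expr1B_le x : 0 <= x <= 1 -> (1 - x) ^+ b * (1 + b%:R * x) <= 1.
Proof.
move=> /andP[x0 x1]; elim: b => [|k IH]; first by rewrite expr0; lra.
apply: le_trans IH; rewrite exprSr -mulrA ler_wpM2l ?exprn_ge0 ?subr_ge0//.
by rewrite -natr1; have : 0 <= k%:R :> R by []; nra.
Qed.

(** A second-order lower bound: it beats the linear one by x^2, which is what makes
the critical process die out. *)
Lemma expr1B_ge x : (1 < b)%N -> 0 <= x <= 1 -> 1 - b%:R * x + x ^+ 2 <= (1 - x) ^+ b.
Proof.
move=> + /andP[x0 x1]; elim: b => // -[|[|k]] IH // _.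
  by rewrite expr2; lra.
have {}IH := IH isT; rewrite exprS.
apply: le_trans (_ : (1 - x) * (1 - k.+2%:R * x + x ^+ 2) <= _); last first.
  by rewrite ler_wpM2l// subr_ge0.
rewrite -[k.+3%:R]natr1; have : 1 <= k.+2%:R :> R by rewrite ler1n.
move: (k.+2%:R) => c c1.
have : 0 <= x ^+ 2 * (c - x) by rewrite mulr_ge0 ?sqr_ge0//; lra.
by rewrite !expr2; nra.
Qed.

Lemma survival_map_itv r t : 0 <= r <= 1 -> 0 <= t <= 1 ->
  0 <= survival_map b r t <= 1.
Proof.
move=> /andP[r0 r1] /andP[t0 t1]; rewrite /survival_map.
have rt0 : 0 <= r * t by rewrite mulr_ge0.
have rt1 : r * t <= 1 by rewrite mulr_ile1.
rewrite subr_ge0 lerBlDr lerDl; apply/andP; split.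
  by rewrite exprn_ile1//; lra.
by rewrite exprn_ge0//; lra.
Qed.

Lemma iter_survival_map_itv r n : 0 <= r <= 1 ->
  0 <= iter n (survival_map b r) 1 <= 1.
Proof.
move=> rI; elim: n => [|n IH]; first by rewrite /= ler01 lexx.
by rewrite iterS survival_map_itv.
Qed.

Lemma survival_map_mono r s t : 0 <= r <= 1 -> 0 <= s -> s <= t -> t <= 1 ->
  survival_map b r s <= survival_map b r t.
Proof.
move=> /andP[r0 r1] s0 st t1; rewrite lerB// lerXn2r// ?nnegrE.
- by rewrite subr_ge0 mulr_ile1// (le_trans s0).
- by rewrite subr_ge0 mulr_ile1// (le_trans st).
- by rewrite lerB// ler_wpM2l.
Qed.

(** The bound is s = 1 - 1/(b r): by [expr1B_le] the map sends s to at least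
b r s / (1 + b r s) = s, and it is monotone. *)
Lemma supercritical_iter r : 0 <= r <= 1 -> 1 < b%:R * r ->
  exists2 s, 0 < s & forall n, s <= iter n (survival_map b r) 1.
Proof.
move=> rI br; have /andP[r0 r1] := rI.
have br0 : 0 < b%:R * r by lra.
pose s := 1 - (b%:R * r)^-1.
have s0 : 0 < s by rewrite subr_gt0 invf_lt1.
have s1 : s <= 1 by rewrite lerBlDr lerDl invr_ge0 ltW.
exists s => //; elim=> [|n IH] //.
have /andP[_ i1] := @iter_survival_map_itv r n rI.
rewrite iterS; apply: le_trans (survival_map_mono rI (ltW s0) IH i1).
rewrite /survival_map lerBrDr -lerBrDl.
have := @expr1B_le (r * s); rewrite mulrA.
have rs0 : 0 <= r * s by rewrite mulr_ge0// ltW.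
rewrite rs0 mulr_ile1 ?(ltW s0)// => /(_ isT).
have -> : 1 + b%:R * r * s = b%:R * r.
  by rewrite /s mulrBr mulfV ?gt_eqF//; ring.
rewrite -ler_pdivlMr// => /le_trans; apply.
by rewrite /s mul1r; lra.
Qed.

(** For r = 1/b the map lowers t by at least (t/b)^2. If the iterates stayed above
e they would decrease linearly and become negative. *)
Lemma critical_iter : (1 < b)%N ->
  forall e : R, 0 < e -> exists n, iter n (survival_map b (b%:R^-1)) 1 < e.
Proof.
move=> b1 e e0; set r := b%:R^-1.
have b0 : 0 < b%:R :> R by rewrite ltr0n; lia.
have rI : 0 <= r <= 1.
  by rewrite invr_ge0 ler0n invf_le1// ler1n; lia.
have decay t : 0 <= t <= 1 -> survival_map b r t <= t - (r * t) ^+ 2.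
  move=> /andP[t0 t1]; have /andP[r0 r1] := rI.
  have := @expr1B_ge (r * t) b1; rewrite mulr_ge0// mulr_ile1// => /(_ isT).
  rewrite mulrA /r mulfV ?gt_eqF// mul1r -/r /survival_map => H; lra.
apply: contrapT => H.
have {}H n : e <= iter n (survival_map b r) 1.
  by rewrite leNgt; apply/negP => h; apply: H; exists n.
have re0 : 0 < (r * e) ^+ 2 by rewrite exprn_gt0// mulr_gt0// invr_gt0.
have dec n : iter n (survival_map b r) 1 <= 1 - n%:R * (r * e) ^+ 2.
  elim: n => [|n IH]; first by rewrite mul0r subr0.
  rewrite iterS; apply: le_trans (decay _ (iter_survival_map_itv _ rI)) _.
  have : (r * e) ^+ 2 <= (r * iter n (survival_map b r) 1) ^+ 2.
    have /andP[r0 _] := rI.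
    by rewrite lerXn2r ?nnegrE ?mulr_ge0 ?(ltW e0) ?(le_trans (ltW e0) (H _))// ler_wpM2l.
  by rewrite -natr1; lra.
have := dec (Num.truncn ((r * e) ^+ 2)^-1).+1.
have := Num.Theory.truncnS_gt ((r * e) ^+ 2)^-1.
set k := (Num.truncn _).+1; rewrite invf_plt ?posrE// => kr kd.
have : 1 < k%:R * (r * e) ^+ 2.
  by rewrite -ltr_pdivrMl ?mulr1// ltr0n.
by have := H k; lra.
Qed.

End SurvivalMap.

(** * Energy, the Caccioppoli inequality and Liouville's theorem *)

Section Energy.
Context (R : realType) (V : choiceType) (o : V) (b : nat) (T : rtree o b).
Local Notation lv := (lv T).
Local Notation par := (par T).
Local Notation ch := (ch T).
Context (c : V -> R).
Hypothesis c_gt0 : forall i, 0 < c i.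
Implicit Types (f g phi psi : V -> R).

Lemma root_lv0 v : (v == o) = (lv v == 0%N).
Proof.
apply/eqP/eqP => [->|]; first exact: lv_root.
by case: (eqVneq v o) => // /(lv_par T) ->.
Qed.

(** The Dirichlet energy of f on the edges below v, down to relative depth n. *)
Fixpoint energy n v f : R :=
  if n is n'.+1 then \sum_(i <- ch v) (c i * (f v - f i) ^+ 2 + energy n' i f)
  else 0.

(** The Dirichlet form of -g and f on the edges below v: the increments of g are
taken outwards and those of f inwards. *)
Fixpoint pairing g n v f : R :=
  if n is n'.+1 then
    \sum_(i <- ch v) (c i * (g i - g v) * (f v - f i) + pairing g n' i f)
  else 0.

(** The energy of g with the weight f^2, symmetrized over each edge. *)
Fixpoint weighted_energy g n v f : R :=
  if n is n'.+1 then
    \sum_(i <- ch v) (c i * (g i - g v) ^+ 2 * (f v ^+ 2 + f i ^+ 2) + weighted_energy g n' i f)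
  else 0.

Definition outflow g v := \sum_(i <- ch v) c i * (g i - g v).

(** At every vertex, what flows in from the parent flows out to the children. *)
Definition harmonic_at g v :=
  outflow g v = if v == o then 0 else c v * (g v - g (par v)).

(** Summation by parts, from the leaves upwards: each edge contributes its flow
times the difference of psi, and conservation of flow at the lower endpoint
cancels the part that comes from below. The hypothesis lets conservation fail
where psi vanishes. *)
Lemma pairing_outflow g n v psi :
  (forall y, y != o -> psi y = 0 \/ harmonic_at g y) ->
  (forall y, lv y = (lv v + n)%N -> psi y = 0) ->
  pairing g n v psi = psi v * outflow g v.
Proof.
move=> harm; elim: n v => [|n IH] v psi0.
  by rewrite /= psi0 ?addn0// mul0r.
rewrite /= /outflow mulr_sumr; apply: eq_big_seq => i iv.
have [io pi li] := chP iv.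
rewrite IH; last by move=> y ly; apply: psi0; rewrite ly li addSnnS.
case: (harm i io) => [->|]; first by rewrite mul0r; ring.
by rewrite /harmonic_at (negbTE io) pi => ->; ring.
Qed.

(** After completing squares the difference of the two sides is
(D (fv + fi) + 4 (fi - fv) m)^2 / 2 + 8 (fi - fv)^2 (1 - m^2) + (D (fi - fv))^2 / 2
with D = gi - gv and m the mean of gv and gi, which is at most 1. *)
Lemma caccioppoli_edge (gv gi fv fi : R) : 0 <= gv <= 1 -> 0 <= gi <= 1 ->
  (gi - gv) ^+ 2 * (fv ^+ 2 + fi ^+ 2) <=
  8 * (fv - fi) ^+ 2 - 4 * ((gi - gv) * (fv ^+ 2 * gv - fi ^+ 2 * gi)).
Proof.
move=> /andP[gv0 gv1] /andP[gi0 gi1]; rewrite -subr_ge0.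
pose m := (gi + gv) / 2.
have -> : 8 * (fv - fi) ^+ 2 - 4 * ((gi - gv) * (fv ^+ 2 * gv - fi ^+ 2 * gi)) -
  (gi - gv) ^+ 2 * (fv ^+ 2 + fi ^+ 2) =
  2^-1 * ((gi - gv) * (fv + fi) + 4 * (fi - fv) * m) ^+ 2 +
  8 * (fi - fv) ^+ 2 * (1 - m ^+ 2) + 2^-1 * ((gi - gv) * (fi - fv)) ^+ 2.
  by rewrite /m; field.
have m1 : m ^+ 2 <= 1.
  have mI : 0 <= m <= 1 by rewrite /m; lra.
  by move: mI => /andP[m0 m1]; rewrite expr_le1.
have := sqr_ge0 ((gi - gv) * (fv + fi) + 4 * (fi - fv) * m).
have := sqr_ge0 ((gi - gv) * (fi - fv)).
have : 0 <= (fi - fv) ^+ 2 * (1 - m ^+ 2) by rewrite mulr_ge0 ?sqr_ge0// subr_ge0.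
lra.
Qed.

(** The edge inequality, summed. *)
Lemma caccioppoli g n v phi : (forall y, 0 <= g y <= 1) ->
  weighted_energy g n v phi <=
  8 * energy n v phi - 4 * pairing g n v (fun y => phi y ^+ 2 * g y).
Proof.
move=> gI; elim: n v => [|n IH] v; first by rewrite /= !mulr0 subr0.
rewrite /= !mulr_sumr -sumrB; apply: ler_sum => i _.
have H := ler_wpM2l (ltW (c_gt0 i)) (caccioppoli_edge (phi v) (phi i) (gI v) (gI i)).
rewrite -mulrA; apply: le_trans (lerD H (IH i)) _.
by rewrite le_eqVlt; apply/orP; left; apply/eqP; ring.
Qed.

Lemma weighted_energy_ge0 g n v f : 0 <= weighted_energy g n v f.
Proof.
elim: n v => //= n IH v; apply: sumr_ge0 => i _.
by rewrite addr_ge0// mulr_ge0// ?addr_ge0 ?sqr_ge0// mulr_ge0 ?sqr_ge0// ltW.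
Qed.

Lemma weighted_energy_child g n i f : i != o ->
  c i * (g i - g (par i)) ^+ 2 * (f (par i) ^+ 2 + f i ^+ 2) + weighted_energy g n i f <=
  weighted_energy g n.+1 (par i) f.
Proof.
move=> io; have iv : i \in ch (par i) by rewrite mem_ch io eqxx.
rewrite /= (big_rem i iv)/= lerDl sumr_ge0// => j _.
rewrite addr_ge0 ?weighted_energy_ge0//.
by rewrite mulr_ge0// ?addr_ge0 ?sqr_ge0// mulr_ge0 ?sqr_ge0// ltW.
Qed.

Lemma weighted_energy_sub g N v f : (lv v <= N)%N ->
  weighted_energy g (N - lv v) v f <= weighted_energy g N o f.
Proof.
elim: {v}(lv v) {-2}v (erefl (lv v)) => [|k IH] v lk vN.
  by have /eqP -> : v == o by [rewrite root_lv0 lk]; rewrite lv_root subn0.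
have vo : v != o by rewrite root_lv0 lk.
have lp : lv (par v) = k by move: (lv_par T vo); rewrite lk => -[].
apply: le_trans (IH _ lp _); last by lia.
have -> : (N - lv (par v) = (N - k.+1).+1)%N by lia.
apply: le_trans (weighted_energy_child g (N - k.+1) f vo).
by rewrite lk lerDr mulr_ge0// ?addr_ge0 ?sqr_ge0// mulr_ge0 ?sqr_ge0// ltW.
Qed.

(** Test harmonicity against phi^2 g. As g vanishes at x, the exceptional point is
invisible, and the energy of g near any given edge is at most a multiple of
that of the cutoff phi, which is arbitrarily small. So g is constant. *)
Lemma liouville g x : (forall y, 0 <= g y <= 1) -> g x = 0 ->
  (forall y, y != x -> harmonic_at g y) ->
  (forall m (e : R), 0 < e -> exists phi N, [/\ (m <= N)%N,
     forall y, (lv y <= m)%N -> phi y = 1,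
     forall y, (N <= lv y)%N -> phi y = 0 & energy N o phi <= e]) ->
  forall y, g y = 0.
Proof.
move=> gI gx harm cutoff.
have const_edge y : y != o -> g y = g (par y).
  move=> yo; apply/eqP; rewrite -subr_eq0 -sqrf_eq0 eq_le sqr_ge0 andbT.
  rewrite -(pmulr_rle0 _ (c_gt0 y)); apply/ler_addgt0Pl => e e0; rewrite addr0.
  have [phi [N [mN phi1 phi0 phiE]]] := cutoff (lv y) (e / 4) (divr_gt0 e0 (ltr0Sn _ _)).
  have := caccioppoli N o phi gI.
  rewrite pairing_outflow; last 2 first.
  - move=> z zo; case: (eqVneq z x) => [->|/harm]; last by right.
    by left; rewrite gx mulr0.
  - by move=> z lz; rewrite phi0 ?expr0n ?mul0r// lz; lia.
  have -> : phi o ^+ 2 * g o * outflow g o = 0.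
    case: (eqVneq o x) => [->|/harm]; first by rewrite gx mulr0 mul0r.
    by rewrite /harmonic_at eqxx => ->; rewrite mulr0.
  have lpy := lv_par T yo.
  have := @weighted_energy_sub g N (par y) phi; have -> : (lv (par y) <= N)%N by lia.
  move=> /(_ isT); have -> : (N - lv (par y) = (N - lv y).+1)%N by lia.
  have := weighted_energy_child g (N - lv y) phi yo.
  have := weighted_energy_ge0 g (N - lv y) y phi.
  rewrite !phi1//; last by lia.
  rewrite expr1n; lra.
have go y : g y = g o.
  elim: {y}(lv y) {-2}y (erefl (lv y)) => [|k IH] y lk.
    by have /eqP -> : y == o by rewrite root_lv0 lk.
  have yo : y != o by rewrite root_lv0 lk.
  by rewrite const_edge// IH//; move: (lv_par T yo); rewrite lk => -[].
by move=> y; rewrite go -(go x).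
Qed.

(** Cross terms vanish when no edge sees a change of both functions. *)
Lemma energyD n v f f' :
  (forall i, i != o -> (f (par i) - f i) * (f' (par i) - f' i) = 0) ->
  energy n v (fun y => f y + f' y) = energy n v f + energy n v f'.
Proof.
move=> ff'; elim: n v => [|n IH] v; first by rewrite /= addr0.
rewrite /= -big_split /=; apply: eq_big_seq => i /chP[io pi _].
have := ff' _ io; rewrite pi => H; rewrite IH.
have -> : (f v + f' v - (f i + f' i)) ^+ 2 = (f v - f i) ^+ 2 + (f' v - f' i) ^+ 2
   + 2 * ((f v - f i) * (f' v - f' i)) by ring.
by rewrite H; ring.
Qed.

Lemma energyZ n v f (a : R) : energy n v (fun y => a * f y) = a ^+ 2 * energy n v f.
Proof.
elim: n v => [|n IH] v; first by rewrite /= mulr0.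
by rewrite /= mulr_sumr; apply: eq_bigr => i _; rewrite IH; ring.
Qed.

(** The mean of K cutoffs with disjoint transition regions has energy at most
K C / K^2: this is the mechanism of the Nash-Williams criterion. *)
Lemma cutoff_average (C : R) :
  (forall m, (0 < m)%N -> exists phi M, [/\ (m < M)%N,
     forall y, (lv y <= m)%N -> phi y = 1,
     forall y, (M <= lv y)%N -> phi y = 0 & forall N, energy N o phi <= C]) ->
  forall m (e : R), 0 < e -> exists phi N, [/\ (m <= N)%N,
     forall y, (lv y <= m)%N -> phi y = 1,
     forall y, (N <= lv y)%N -> phi y = 0 & energy N o phi <= e].
Proof.
move=> block m e e0.
have sum_blocks K : exists psi M, [/\ (m < M)%N,
     forall y, (lv y <= m)%N -> psi y = K%:R,
     forall y, (M <= lv y)%N -> psi y = 0 & forall N, energy N o psi <= K%:R * C].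
  elim: K => [|K [psi [M [mM psi1 psi0 psiE]]]].
    exists (fun=> 0), m.+1; split=> // N; rewrite mul0r.
    suff -> : energy N o (fun=> 0) = 0 by [].
    elim: N o => //= N IH v; rewrite big1// => i _.
    by rewrite IH subrr expr0n mulr0 addr0.
  have [phi [M' [MM' phi1 phi0 phiE]]] := block M ltac:(lia).
  exists (fun y => psi y + phi y), M'; split; first by lia.
  - by move=> y ym; rewrite psi1// phi1 ?natr1//; lia.
  - by move=> y yM; rewrite psi0 ?phi0 ?addr0//; lia.
  - move=> N; rewrite energyD.
      by rewrite -natr1 mulrDl mul1r lerD.
    move=> i io; have li := lv_par T io.
    have [iM|Mi] := leqP (lv i) M.
      by rewrite !phi1 ?subrr ?mulr0//; lia.
    by rewrite !psi0 ?subrr ?mul0r//; lia.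
(* The average of K blocks has energy at most C / K, hence K > |C| / e. *)
pose K := (Num.truncn (`|C| / e)).+1.
have Ke : `|C| / e < K%:R by exact: Num.Theory.truncnS_gt.
have K0 : 0 < K%:R :> R by rewrite ltr0n.
have [psi [M [mM psi1 psi0 psiE]]] := sum_blocks K.
exists (fun y => K%:R^-1 * psi y), M; split; first by lia.
- by move=> y ym; rewrite psi1// mulVf ?gt_eqF.
- by move=> y yM; rewrite psi0// mulr0.
- rewrite energyZ expr2 -mulrA ler_pdivrMl//.
  apply: le_trans (_ : `|C| <= _).
    by rewrite ler_pdivrMl//; apply: le_trans (psiE M) _; rewrite ler_wpM2l ?ler_norm// ltW.
  by rewrite -ler_pdivrMr// ltW.
Qed.

End Energy.

(** * Cutoff functions along open paths *)

Section OpenPaths.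
Context (V : choiceType) (o : V) (b : nat) (T : rtree o b).
Local Notation lv := (lv T).
Local Notation par := (par T).
Local Notation ch := (ch T).
Implicit Type O : V -> bool.

(** All edges from y up to level m are open; it holds when y is at level m or
above, for lack of such edges. *)
Definition alive O m y := all (fun k => O (iter k par y)) (iota 0 (lv y - m)).

Lemma alive_top O m y : (lv y <= m)%N -> alive O m y.
Proof. by rewrite /alive -subn_eq0 => /eqP ->. Qed.

Lemma alive_child O m i : i != o -> (m < lv i)%N ->
  alive O m i = O i && alive O m (par i).
Proof.
move=> io mi; rewrite /alive; have li := lv_par T io.
have -> : (lv i - m = (lv (par i) - m).+1)%N by lia.
rewrite /= (iotaDl 1 0) all_map; congr (_ && _).
by apply: eq_all => k; rewrite /= add0n /= -iterSr.
Qed.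

End OpenPaths.

Section Cutoff.
Context (R : realType) (V : choiceType) (o : V) (b : nat) (T : rtree o b).
Local Notation lv := (lv T).
Local Notation par := (par T).
Local Notation ch := (ch T).
Context (l1 l2 : R) (O : V -> bool).
Hypotheses (b_gt0 : (0 < b)%N) (l1_gt0 : 0 < l1) (l2_ge : b%:R <= l2).

(** The conductance of the edge from i to its parent, whose level is one less. At
the root the exponent is 0, so the value is 1. *)
Definition level_cond i := (if O i then l1 else l2) ^- (lv i).-1.

Lemma branch_gt0 : 0 < b%:R :> R. Proof. by rewrite ltr0n. Qed.

Lemma level_cond_gt0 i : 0 < level_cond i.
Proof.
rewrite invr_gt0 exprn_gt0//; case: (O i) => //; exact: lt_le_trans branch_gt0 l2_ge.
Qed.

(** One up to level m, then one along open paths for fewer than L steps: it drops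
to zero at the first closed edge, or at the L-th open one. *)
Definition cutoff m L y : R := ((lv y < m + L)%N && alive T O m y)%:R.

Section Block.
Variables (m L : nat).
Hypotheses (m_gt0 : (0 < m)%N) (L_gt0 : (0 < L)%N).
Local Notation phi := (cutoff m L).

Lemma cutoff_top y : (lv y <= m)%N -> phi y = 1.
Proof. by move=> ym; rewrite /cutoff alive_top// andbT (_ : (_ < _)%N)//; lia. Qed.

Lemma cutoff_bot y : (m + L <= lv y)%N -> phi y = 0.
Proof. by rewrite /cutoff leqNgt => /negbTE ->. Qed.

Lemma cutoff_child i : i != o -> (m < lv i)%N ->
  phi i = (lv i < m + L)%:R * (O i)%:R * phi (par i).
Proof.
move=> io mi; rewrite /cutoff alive_child//.
have -> : (lv (par i) < m + L)%N = ((lv i < m + L) || (lv (par i) < m + L))%N.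
  by rewrite (lv_par T io); lia.
by case: (_ < _)%N; rewrite ?mul0r// mul1r /=; case: (O i); rewrite ?mul0r// mul1r.
Qed.

(** Below its first zero the cutoff stays zero. *)
Lemma energy_dead N v : (m <= lv v)%N -> phi v = 0 -> energy T level_cond N v phi = 0.
Proof.
elim: N v => //= N IH v mv pv; rewrite big_seq big1// => i /chP[io pi li].
have pi0 : phi i = 0 by rewrite cutoff_child// ?pi ?pv ?mulr0//; lia.
by rewrite pv pi0 subrr expr0n mulr0 add0r IH//; lia.
Qed.

Lemma pow_child (x : R) k : 0 < x -> x * x ^- k.+1 = x ^- k.
Proof. by move=> x0; rewrite exprS invfM mulrA mulfV ?mul1r// gt_eqF. Qed.

(** At a vertex where the cutoff is still one, the closed edges met below cost at
most b b^-k, by induction: each of the b children has either a closed edge,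
which costs at most b^-k because l2 >= b, or passes on a budget of
b b^-(k+1) = b^-k. The paths that stay open cost their conductance
l1 l1^-(m+L), which [path_weight] records relative to v. *)
Lemma energy_block N n v : v != o -> (m <= lv v)%N -> (lv v + n)%N = (m + L)%N ->
  phi v = 1 ->
  energy T level_cond N v phi <=
  b%:R * b%:R ^- lv v + l1 * l1 ^- lv v * path_weight T l1 n v O.
Proof.
elim: n N v => [|n IH] N v vo mv lvn pv.
  by move: pv; rewrite cutoff_bot ?lvn// ?addn0 -?lvn ?addn0// => /eqP; rewrite eq_sym oner_eq0.
case: N => [|N].
  rewrite /energy addr_ge0// mulr_ge0 ?invr_ge0 ?exprn_ge0 ?path_weight_ge0 ?(ltW l1_gt0)//.
  by rewrite mulr_ge0 ?invr_ge0 ?exprn_ge0 ?(ltW l1_gt0).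
have -> : b%:R * b%:R ^- lv v = \sum_(i <- ch v) b%:R ^- lv v :> R.
  by rewrite big_const_seq count_predT iter_addr_0 size_ch (negbTE vo) mulr_natl.
rewrite /path_weight -/(path_weight T l1) mulr_sumr -big_split /= big_seq [leRHS]big_seq.
apply: ler_sum => i /chP[io pi li].
have mi : (m < lv i)%N by lia.
have pvi := cutoff_child io mi; rewrite pi pv mulr1 in pvi.
rewrite /level_cond li /= pv; case: (boolP (O i)) => Oi; last first.
  rewrite (negbTE Oi) mulr0 in pvi.
  rewrite pvi energy_dead//; last by lia.
  rewrite subr0 expr1n mulr1 addr0 !mul0r mulr0 addr0.
  rewrite lef_pV2 ?posrE ?exprn_gt0 ?branch_gt0 ?(lt_le_trans branch_gt0)//.
  by apply: lerXn2r; rewrite ?nnegrE// (le_trans (ltW branch_gt0)).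
rewrite Oi mulr1 in pvi; rewrite mul1r.
have bi : 0 <= b%:R ^- lv v :> R by rewrite invr_ge0 exprn_ge0.
case: n => [|n] in IH lvn *.
  have pi0 : phi i = 0 by rewrite pvi (_ : (_ < _)%N = false)//; lia.
  rewrite pi0 energy_dead//; last by lia.
  rewrite subr0 expr1n mulr1 addr0 /path_weight mul1r.
  by rewrite mulrAC mulfV ?gt_eqF// mul1r lerDr.
have pi1 : phi i = 1 by rewrite pvi (_ : (_ < _)%N)//; lia.
rewrite pi1 subrr expr0n mulr0 add0r.
apply: le_trans (IH N i io (ltnW mi) _ pi1) _; first by lia.
rewrite li !pow_child ?branch_gt0// lerD2l le_eqVlt; apply/orP; left; apply/eqP.
by field; rewrite ?gt_eqF ?exprn_gt0.
Qed.

(** Above level m the cutoff is constant, so the bounds of [energy_block] add up.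
The root has one more child, hence the case distinction. *)
Lemma energy_top N v : (lv v <= m)%N ->
  energy T level_cond N v phi <=
  ((v == o) + b)%:R * b%:R ^- lv v +
  l1 * l1 ^- m * level_sum T (path_weight T l1 L) (m - lv v) v O.
Proof.
move: {2}(m - lv v)%N (erefl (m - lv v)%N) => j.
elim: j N v => [|j IH] N v mvj vm.
  have lvm : lv v = m by lia.
  have vo : v != o by rewrite (root_lv0 T) lvm -lt0n.
  rewrite mvj /= (negbTE vo) add0n; have := @energy_block N L v vo; rewrite lvm.
  by apply=> //; rewrite cutoff_top// lvm.
have ls0 k u : 0 <= l1 * l1 ^- m * level_sum T (path_weight T l1 L) k u O.
  rewrite mulr_ge0 ?level_sum_ge0 ?mulr_ge0 ?invr_ge0 ?exprn_ge0 ?(ltW l1_gt0)//.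
  by move=> i; rewrite path_weight_ge0// ltW.
case: N => [|N].
  by rewrite /energy addr_ge0// mulr_ge0// invr_ge0 exprn_ge0.
rewrite mvj /level_sum -/(level_sum T (path_weight T l1 L)).
have -> : ((v == o) + b)%:R * b%:R ^- lv v = \sum_(i <- ch v) b%:R ^- lv v :> R.
  by rewrite big_const_seq count_predT iter_addr_0 size_ch mulr_natl.
rewrite mulr_sumr -big_split /= big_seq [leRHS]big_seq.
apply: ler_sum => i /chP[io pi li].
rewrite !cutoff_top ?li; [|lia|lia].
rewrite subrr expr0n mulr0 add0r.
have ji : (m - lv i)%N = j by lia.
apply: le_trans (IH N i ji _) _; first by lia.
by rewrite ji (negbTE io) add0n li pow_child// branch_gt0.
Qed.

End Block.

(** Arbitrarily small total weight of the open paths of a suitable common length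
that start at level m. *)
Definition thin_below :=
  forall m (e : R), (0 < m)%N -> 0 < e ->
  exists2 L, (0 < L)%N & level_sum T (path_weight T l1 L) m o O <= e.

(** Thinness is used with e = l1^m / l1, which turns the second term of the bound of
[energy_top] into 1. *)
Lemma thin_cutoff : thin_below ->
  forall m (e : R), 0 < e -> exists phi N, [/\ (m <= N)%N,
     forall y, (lv y <= m)%N -> phi y = 1,
     forall y, (N <= lv y)%N -> phi y = 0 & energy T level_cond N o phi <= e].
Proof.
move=> thin; apply: (@cutoff_average _ _ _ _ T level_cond b.+2%:R) => m m0.
have le0 : 0 < l1 ^+ m / l1 by rewrite divr_gt0 ?exprn_gt0.
have [L L0 HL] := thin m _ m0 le0.
exists (cutoff m L), (m + L)%N; split; first by lia.
- by move=> y; exact: cutoff_top.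
- by move=> y; exact: cutoff_bot.
move=> N; apply: le_trans (energy_top m0 L0 N _) _; first by rewrite lv_root.
rewrite lv_root expr0 invr1 mulr1 eqxx subn0 -[b.+2%:R]natr1 lerD2l.
apply: le_trans (_ : l1 * l1 ^- m * (l1 ^+ m / l1) <= _).
  by rewrite ler_wpM2l// mulr_ge0 ?invr_ge0 ?exprn_ge0 ?(ltW l1_gt0).
rewrite le_eqVlt; apply/orP; left; apply/eqP.
by field; rewrite ?gt_eqF ?exprn_gt0.
Qed.

End Cutoff.

(** * Infinite survival and the escape voltage *)

Lemma cvg_sum_seq (R : realType) (I : Type) (l : seq I) (f : nat -> I -> R)
  (a : I -> R) :
  (forall i, f n i @[n --> \oo] --> a i) ->
  \sum_(i <- l) f n i @[n --> \oo] --> \sum_(i <- l) a i.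
Proof.
move=> fa; elim: l => [|i l IH].
  by rewrite big_nil; under eq_cvg do rewrite big_nil; exact: cvg_cst.
rewrite big_cons; under eq_cvg do rewrite big_cons.
exact: cvgD.
Qed.

Section SurvivalLimit.
Context (R : realType) (V : choiceType) (o : V) (b : nat) (T : rtree o b).
Local Notation lv := (lv T).
Local Notation par := (par T).
Local Notation ch := (ch T).
Context (lam : R) (O : V -> bool).
Hypothesis lam_ge1 : 1 <= lam.

(** The infimum is the limit, survival being nonincreasing in n. *)
Definition survival_lim v := inf (range (fun n => survival T lam n v O)).

Lemma survival_cvg v : survival T lam n v O @[n --> \oo] --> survival_lim v.
Proof.
apply: nonincreasing_cvgn; first by move=> m n mn; exact: survival_anti.
by exists 0 => _ [n _ <-]; have /andP[] := survival_itv T n v O lam_ge1.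
Qed.

Lemma survival_lim_ge v (s : R) : (forall n, s <= survival T lam n v O) ->
  s <= survival_lim v.
Proof. move=> H; apply: (cvgr_to_ge (@survival_cvg v)); exact: nearW.
Qed.

Lemma survival_lim_le v n : survival_lim v <= survival T lam n v O.
Proof.
apply: (cvgr_to_le (@survival_cvg v)); exists n => // k /= nk; exact: survival_anti.
Qed.

Lemma survival_lim_itv v : 0 <= survival_lim v <= 1.
Proof.
rewrite survival_lim_ge/=; last by move=> n; have /andP[] := survival_itv T n v O lam_ge1.
exact: (survival_lim_le v 0).
Qed.

Lemma survival_lim_le_sum v :
  survival_lim v <= \sum_(i <- ch v) (O i)%:R * survival_lim i / lam.
Proof.
have : (\sum_(i <- ch v) (O i)%:R * survival T lam n i O / lam) @[n --> \oo] -->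
    \sum_(i <- ch v) (O i)%:R * survival_lim i / lam.
  apply: cvg_sum_seq => i; apply: cvgM; last exact: cvg_cst.
  by apply: cvgM; [exact: cvg_cst|exact: survival_cvg].
move=> /cvgr_to_ge; apply; apply: nearW => n.
exact: le_trans (survival_lim_le v n.+1) (survival_le_sum _ _ _ _ _).
Qed.

End SurvivalLimit.

Section Escape.
Context (R : realType) (V : choiceType) (o : V) (b : nat) (T : rtree o b).
Local Notation lv := (lv T).
Local Notation par := (par T).
Local Notation ch := (ch T).
Context (l1 l2 lam : R) (O : V -> bool).
Hypotheses (l1_gt0 : 0 < l1) (l2_gt0 : 0 < l2) (lam_ge1 : 1 <= lam)
  (l1_lam : l1 < lam).
Local Notation survival_lim := (survival_lim T lam O).
Local Notation level_cond := (level_cond T l1 l2 O).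

(** A lower bound for the effective conductance from v to infinity below v, in units
of the conductance l1^-k of the open edges just below v: as
l1 + eff_cond <= lam, the union bound makes it a subsolution of the
series-parallel recursion. *)
Definition eff_cond v := (lam - l1) * survival_lim v.

Lemma eff_cond_ge0 v : 0 <= eff_cond v.
Proof. by rewrite mulr_ge0 ?subr_ge0 ?(ltW l1_lam)//; have /andP[] := survival_lim_itv T O lam_ge1 v. Qed.

(** The factor by which the voltage drops along an open edge, seen as a resistor in
series with the conductance below it; along a closed edge no current flows. *)
Definition volt_ratio v := if O v then l1 / (l1 + eff_cond v) else 1.

Lemma volt_ratio_itv v : 0 < volt_ratio v <= 1.
Proof.
rewrite /volt_ratio; case: (O v); last by rewrite ltr01 lexx.
have H : 0 < l1 + eff_cond v by rewrite ltr_wpDr// eff_cond_ge0.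
by rewrite divr_gt0//= ler_pdivrMr// mul1r lerDl eff_cond_ge0.
Qed.

Fixpoint volt_rec k v := if k is k'.+1 then volt_rec k' (par v) * volt_ratio v else 1.

(** The voltage at v when the root has voltage 1, a product along the path to v. *)
Definition volt v := volt_rec (lv v) v.

Lemma volt_child i : i != o -> volt i = volt (par i) * volt_ratio i.
Proof. by move=> io; rewrite /volt (lv_par T io). Qed.

Lemma volt_itv v : 0 < volt v <= 1.
Proof.
rewrite /volt; move: (lv v) => n; elim: n v => [|k IH] v /=; first by rewrite ltr01 lexx.
have /andP[r0 r1] := volt_ratio_itv v; have /andP[v0 v1] := IH (par v).
by rewrite mulr_gt0//= mulr_ile1// ltW.
Qed.

Definition escape v := 1 - volt v.

Lemma escape_itv v : 0 <= escape v <= 1.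
Proof. by have := volt_itv v; rewrite /escape; lra. Qed.

Lemma escape_root : escape o = 0.
Proof. by rewrite /escape /volt lv_root subrr. Qed.

(** The current that enters v under the voltage is the left-hand side, and the
subsolution property of [eff_cond] says that at least as much can leave. *)
Lemma outflow_escape v :
  l1 ^- lv v * volt v * eff_cond v <= outflow T level_cond escape v.
Proof.
have /andP[v0 _] := volt_itv v.
rewrite /eff_cond.
apply: le_trans (_ : l1 ^- lv v * volt v *
   ((lam - l1) * \sum_(i <- ch v) (O i)%:R * survival_lim i / lam) <= _).
  rewrite ler_wpM2l ?mulr_ge0 ?invr_ge0 ?exprn_ge0 ?(ltW v0) ?(ltW l1_gt0)//.
  by rewrite ler_wpM2l ?subr_ge0 ?(ltW l1_lam)// survival_lim_le_sum.
rewrite /outflow !mulr_sumr big_seq [leRHS]big_seq; apply: ler_sum => i /chP[io pi li].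
rewrite /escape (volt_child io) pi /level_cond li /= /volt_ratio.
case: (O i); last by rewrite !mul0r !mulr0 mulr1 subrr mulr0.
have -> : 1 - volt v * (l1 / (l1 + eff_cond i)) - (1 - volt v) =
    volt v * (eff_cond i / (l1 + eff_cond i)).
  by field; rewrite gt_eqF// ltr_wpDr// eff_cond_ge0.
rewrite mul1r -mulrA ler_wpM2l ?invr_ge0 ?exprn_ge0 ?(ltW l1_gt0)//.
rewrite ler_wpM2l ?(ltW v0)// mulrA -/(eff_cond i) ler_wpM2l ?eff_cond_ge0//.
have /andP[t0 t1] := survival_lim_itv T O lam_ge1 i.
have a0 := eff_cond_ge0 i.
have lam0 : 0 < lam := lt_le_trans ltr01 lam_ge1.
have la0 : 0 < l1 + eff_cond i by rewrite ltr_wpDr.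
rewrite lef_pV2 ?posrE//.
by rewrite -lerBrDl /eff_cond ler_piMr// subr_ge0 ltW.
Qed.

Lemma escape_subharmonic v : v != o ->
  level_cond v * (escape v - escape (par v)) <= outflow T level_cond escape v.
Proof.
move=> vo; apply: le_trans (outflow_escape v).
have /andP[p0 _] := volt_itv (par v).
have a0 := eff_cond_ge0 v.
rewrite /escape (volt_child vo) /level_cond (lv_par T vo) /= /volt_ratio; case: (O v).
  rewrite le_eqVlt; apply/orP; left; apply/eqP; rewrite exprS.
  by field; rewrite !gt_eqF ?exprn_gt0// ltr_wpDr.
rewrite mulr1 subrr mulr0 mulr_ge0//.
by rewrite mulr_ge0 ?(ltW p0)// invr_ge0 exprn_ge0// ltW.
Qed.

Lemma outflow_root_gt0 : 0 < survival_lim o -> 0 < outflow T level_cond escape o.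
Proof.
move=> t0; apply: lt_le_trans (outflow_escape o).
have /andP[v0 _] := volt_itv o.
by rewrite mulr_gt0 ?mulr_gt0 ?invr_gt0 ?exprn_gt0 ?subr_gt0.
Qed.

End Escape.

(** * Real-valued probabilities *)

Section ProbabilityFacts.
Context (R : realType) (d : measure_display) (T : measurableType d).
Context (P : probability T R).

Definition pr (A : set T) : R := fine (P A).

Lemma prE A : measurable A -> P A = (pr A)%:E.
Proof. by move=> mA; rewrite /pr fineK// fin_num_measure. Qed.

Lemma pr_le A B : measurable A -> measurable B -> A `<=` B -> pr A <= pr B.
Proof.
by move=> mA mB AB; rewrite -lee_fin -!prE// le_measure ?inE.
Qed.

Lemma pr_ge0 A : 0 <= pr A. Proof. by rewrite fine_ge0. Qed.

Lemma pr_DI A B : measurable A -> measurable B ->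
  pr A = pr (A `\` B) + pr (A `&` B).
Proof.
move=> mA mB; apply: EFin_inj; rewrite EFinD -!prE//.
- exact: measureDI.
- exact: measurableI.
- exact: measurableD.
Qed.

Lemma sum_disjoint_le (I : eqType) (l : seq I) (E : I -> set T) A :
  uniq l -> measurable A -> (forall i, measurable (E i)) ->
  (forall i, i \in l -> E i `<=` A) ->
  (forall i j t, E i t -> E j t -> i = j) ->
  \sum_(i <- l) pr (E i) <= pr A.
Proof.
move=> + + mE + dE; elim: l A => [|i l IH] A /=; first by rewrite big_nil pr_ge0.
move=> /andP[il ul] mA EA; rewrite big_cons (pr_DI mA (mE i)) addrC lerD//.
  apply: IH => //; first exact: measurableD.
  move=> j jl t Ejt; split; first by apply: EA Ejt; rewrite inE jl orbT.
  by move=> Eit; move: il; rewrite (dE _ _ _ Eit Ejt) jl.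
by apply: pr_le => //; [exact: measurableI|move=> t Et; split=> //; apply: EA Et; exact: mem_head].
Qed.

(** An almost sure property holds somewhere on every event of positive probability. *)
Lemma ae_exists (Q : set T) A : {ae P, forall t, Q t} -> measurable A -> 0 < pr A ->
  exists2 t, A t & Q t.
Proof.
move=> [N [mN PN0 QN]] mA A0; apply: contrapT => H.
suff : pr A <= 0 by rewrite leNgt A0.
rewrite -[leRHS]/(fine 0%E) -PN0; apply: pr_le => // t At.
by apply: QN => /= Qt; apply: H; exists t.
Qed.

Lemma pr_bigcap_ge (F : nat -> set T) (s : R) : (forall n, measurable (F n)) ->
  (forall n, F n.+1 `<=` F n) -> (forall n, s <= pr (F n)) ->
  s <= pr (\bigcap_n F n).
Proof.
move=> mF decF sF; rewrite -lee_fin -prE; last exact: bigcapT_measurable.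
have Fh : {homo F : n m / (n <= m)%N >-> (m <= n)%O}.
  move=> n m nm; rewrite -(subnK nm); elim: (m - n)%N => // k IH.
  by rewrite addSn; apply: le_trans IH; apply/subsetPset/decF.
have := @nonincreasing_cvg_mu _ _ _ P F _ mF (bigcapT_measurable mF) Fh.
move=> /(_ (le_lt_trans (probability_le1 _ (mF _)) (ltry _))) H.
apply: (cvge_to_ge H); apply: nearW => n /=.
by rewrite prE// lee_fin.
Qed.

End ProbabilityFacts.

(** * Random walks on a locally finite network *)

Section Walk.
Context (R : realType) (V : choiceType) (adj : rel V) (nb : V -> seq V).
Context (c : {fset V} -> R).
Hypotheses (adj_sym : symmetric adj) (adj_irr : irreflexive adj).
Hypotheses (nb_uniq : forall x, uniq (nb x))
  (mem_nb : forall x y, (y \in nb x) = adj x y).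
Hypotheses (nb_neq0 : forall x, nb x != [::]).
Hypotheses (c_gt0 : forall x y, adj x y -> 0 < c [fset x; y]%fset).

Definition mass x := \sum_(z <- nb x) c [fset x; z]%fset.

Lemma mass_gt0 x : 0 < mass x.
Proof.
rewrite /mass; have := nb_neq0 x; have : {in nb x, forall z, adj x z}.
  by move=> z; rewrite mem_nb.
case: (nb x) => // z l H _; rewrite big_cons ltr_pwDl//.
  by apply: c_gt0; apply: H; rewrite mem_head.
rewrite big_seq sumr_ge0// => y yl; apply: ltW; apply: c_gt0; apply: H.
by rewrite inE yl orbT.
Qed.

(** The edges at x correspond to the neighbours of x; loops are excluded by
irreflexivity, which makes this correspondence one-to-one. *)
Lemma trans_probE x z : z \in nb x ->
  trans_prob adj c x z = c [fset x; z]%fset / mass x.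
Proof.
rewrite /trans_prob mem_nb => ->; congr (_ / _).
have -> : [set e | edges adj e /\ x \in e] = [set [fset x; y]%fset | y in [set` nb x]].
  apply/seteqP; split=> e /=.
    move=> [[a [a' [aa' ->]]]]; rewrite !inE => /orP[/eqP ->|/eqP ->].
      by exists a' => //=; rewrite mem_nb.
    by exists a; rewrite /= ?mem_nb 1?adj_sym// fsetUC.
  move=> [y /=]; rewrite mem_nb => xy <-; split; first by exists x, y.
  by rewrite !inE eqxx.
rewrite fsbig_image; last first.
  move=> y y' /[!inE] /= yx y'x /fsetP /(_ y); rewrite !inE eqxx orbT.
  move/esym/orP => -[/eqP yx'|/eqP//].
  by move: yx; rewrite yx' mem_nb adj_irr.
by rewrite -fsbig_seq.
Qed.

Lemma sum_trans_prob x : \sum_(z <- nb x) trans_prob adj c x z = 1.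
Proof.
rewrite big_seq (eq_bigr (fun z => c [fset x; z]%fset / mass x)); last first.
  by move=> z; exact: trans_probE.
by rewrite -mulr_suml -big_seq mulfV// gt_eqF// mass_gt0.
Qed.

Lemma trans_prob_ge0 x z : 0 <= trans_prob adj c x z.
Proof.
case: (boolP (z \in nb x)) => [xz|].
  rewrite trans_probE// divr_ge0// ltW ?mass_gt0// c_gt0//.
  by rewrite -mem_nb.
by rewrite mem_nb /trans_prob => /negbTE ->.
Qed.

Local Notation tp := (trans_prob adj c).

(** For a = true, the probability that the walk from y hits x at one of the times
1, ..., n; for a = false, that it does not. Treating both cases at once lets a
single lower bound, [pr_hit_ge], give upper bounds as well. *)
Fixpoint hit_prob (x : V) (a : bool) n y : R :=
  if n is n'.+1 then
    \sum_(z <- nb y) tp y z * (if z == x then a%:R else hit_prob x a n' z)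
  else (~~ a)%:R.

Lemma hit_prob_compl x n y : hit_prob x true n y = 1 - hit_prob x false n y.
Proof.
elim: n y => [|n IH] y /=; first by rewrite subrr.
rewrite -[X in _ = X - _](sum_trans_prob y) -sumrB; apply: eq_bigr => z _.
by case: eqP => _; rewrite ?IH; ring.
Qed.

Lemma hit_prob_itv x a n y : 0 <= hit_prob x a n y <= 1.
Proof.
elim: n y => [|n IH] y /=; first by case: a; rewrite /= ?ler01 lexx.
have H z : 0 <= (if z == x then a%:R else hit_prob x a n z) <= 1.
  by case: eqP => // _; case: a {IH}; rewrite /= ?ler01 lexx.
apply/andP; split.
  by apply: sumr_ge0 => z _; rewrite mulr_ge0 ?trans_prob_ge0//; have /andP[] := H z.
rewrite -[leRHS](sum_trans_prob y); apply: ler_sum => z _.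
by rewrite ler_piMr ?trans_prob_ge0//; have /andP[] := H z.
Qed.

Lemma hit_prob_anti x m n y : (m <= n)%N ->
  hit_prob x false n y <= hit_prob x false m y.
Proof.
move=> mn; rewrite -(subnK mn); elim: (n - m)%N => // k; apply: le_trans.
rewrite addSn; move: (k + m)%N => {m n mn k} n; elim: n y => [|n IH] y.
  by have /andP[] := hit_prob_itv x false 1 y.
apply: ler_sum => z _; rewrite ler_wpM2l ?trans_prob_ge0//.
by case: eqP => // _; exact: IH.
Qed.

Section Realization.
Context (x0 x : V) (dT : measure_display) (T : measurableType dT).
Context (P : probability T R) (X : nat -> T -> V).
Hypothesis walkX : is_random_walk adj c x0 P X.

Definition cylinder (z : nat -> V) k := [set t | forall j, (j <= k)%N -> X j t = z j].

Definition hit n k t := has (fun j => X (k + j.+1) t == x) (iota 0 n).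

Lemma measurable_cylinder z k : measurable (cylinder z k).
Proof.
rewrite (_ : cylinder z k = \bigcap_(j in [set j | (j <= k)%N]) (X j @^-1` [set z j])).
  by apply: bigcap_measurableType => j _; exact: walkX.1.
by apply/seteqP; split=> t /= H j /=; exact: H.
Qed.

Lemma measurable_hit n k a : measurable [set t | hit n k t = a].
Proof.
have H : measurable [set t | hit n k t].
  rewrite (_ : mkset _ = \bigcup_(j in [set j | (j < n)%N]) (X (k + j.+1) @^-1` [set x])).
    by apply: bigcup_measurable => j _; exact: walkX.1.
  apply/seteqP; split=> t /=.
    by move=> /hasP[j]; rewrite mem_iota /= add0n => jn /eqP Xj; exists j.
  by move=> [j /= jn Xj]; apply/hasP; exists j; rewrite ?mem_iota ?add0n//; apply/eqP.
case: a; first exact: H.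
rewrite (_ : mkset _ = ~` [set t | hit n k t]); first exact: measurableC.
by apply/seteqP; split=> t /=; [move=> -> | move/negP/negbTE].
Qed.

Lemma pr_cylinder z k :
  pr P (cylinder z k) = (z 0%N == x0)%:R * \prod_(j < k) tp (z j) (z j.+1).
Proof. by rewrite /pr /cylinder walkX.2. Qed.

Definition set_at (z : nat -> V) k y := fun j => if j == k then y else z j.

Lemma cylinder_set_at z k y :
  cylinder (set_at z k.+1 y) k.+1 = cylinder z k `&` [set t | X k.+1 t = y].
Proof.
apply/seteqP; split=> t /=.
  move=> H; split; last by rewrite H// /set_at eqxx.
  by move=> j jk; rewrite H 1?leqW// /set_at; case: eqP => // jk1; move: jk; rewrite jk1 ltnn.
move=> [H1 H2] j; rewrite /set_at leq_eqVlt ltnS; case: eqP => [-> _|_ /=]; first exact: H2.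
exact: H1.
Qed.

Lemma pr_cylinder_set_at z k y :
  pr P (cylinder (set_at z k.+1 y) k.+1) = pr P (cylinder z k) * tp (z k) y.
Proof.
rewrite !pr_cylinder big_ord_recr /= mulrA; congr (_ * _ * _).
  apply: eq_bigr => j _; rewrite /set_at /= !eqSS.
  rewrite (ltn_eqF (leqW (ltn_ord j))).
  by rewrite (ltn_eqF (ltn_ord j)).
by rewrite /set_at eqxx ltn_eqF.
Qed.

Lemma hitS n k t : hit n.+1 k t = (X k.+1 t == x) || hit n k.+1 t.
Proof.
rewrite /hit /= addn1; congr (_ || _).
rewrite (iotaDl 1 0) has_map; apply: eq_has => j /=.
by rewrite add1n addSnnS.
Qed.

(** By induction on n, splitting according to the next vertex. Only neighbours are
summed over, so this is a lower bound; applied to both values of a it is sharp,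
and it does not matter that the walk may leave the graph on a null event. *)
Lemma pr_hit_ge a n k z :
  pr P (cylinder z k) * hit_prob x a n (z k) <=
  pr P (cylinder z k `&` [set t | hit n k t = a]).
Proof.
elim: n k z => [|n IH] k z.
  case: a => /=; first by rewrite mulr0 pr_ge0.
  by rewrite mulr1 (_ : mkset _ = setT) ?setIT//; apply/seteqP; split.
pose E y := cylinder (set_at z k.+1 y) k.+1 `&`
  (if y == x then (if a then setT else set0) else [set t | hit n k.+1 t = a]).
apply: le_trans (_ : \sum_(y <- nb (z k)) pr P (E y) <= _).
  rewrite [hit_prob _ _ _ _]/= mulr_sumr; apply: ler_sum => y _.
  rewrite mulrA -pr_cylinder_set_at /E; case: eqP => yx.
    case: {IH E} a; first by rewrite mulr1 setIT.
    by rewrite mulr0 pr_ge0.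
  have -> : hit_prob x a n y = hit_prob x a n (set_at z k.+1 y k.+1) by rewrite /set_at eqxx.
  exact: IH.
have mE y : measurable (E y).
  apply: measurableI; first exact: measurable_cylinder.
  case: eqP => _; last exact: measurable_hit.
  by case: (a).
have mA : measurable (cylinder z k `&` [set t | hit n.+1 k t = a]).
  by apply: measurableI; [exact: measurable_cylinder|exact: measurable_hit].
apply: sum_disjoint_le => //.
- move=> y _ t; rewrite /E cylinder_set_at => -[[cz Xy] Ht]; split=> //=.
  rewrite hitS Xy; case: eqP Ht => //= _; case: (a) => //.
- move=> y y' t; rewrite /E !cylinder_set_at => -[[_ Xy] _] [[_ Xy'] _].
  by rewrite -Xy -Xy'.
Qed.

End Realization.

(** The lower bound on hitting within n steps, for a = true, bounds the probability
of never returning. *)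
Lemma recurrent_of_hit_prob :
  (forall x e, 0 < e -> exists n, hit_prob x false n x <= e) -> recurrent adj c.
Proof.
move=> H x dT T P X walkX.
pose N := \bigcap_n [set t | hit x X n 0 t = false].
have mN : measurable N.
  by apply: bigcapT_measurable => n; exact: measurable_hit walkX _ _ _.
exists N; split=> //; last first.
  move=> t /= Ht n _ /=; apply/negP => /hasP[j _ /eqP Xj].
  by apply: Ht; exists (0 + j.+1)%N.
rewrite prE//; congr EFin; apply/eqP; rewrite eq_le pr_ge0 andbT.
apply/ler_addgt0Pl => e e0; rewrite addr0.
have [n Hn] := H x e e0; apply: le_trans Hn.
have mh a : measurable [set t | hit x X n 0 t = a] by exact: measurable_hit walkX _ _ _.
apply: le_trans (_ : pr P [set t | hit x X n 0 t = false] <= _).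
  by apply: pr_le => // t; apply.
have := pr_hit_ge x walkX true n 0 (fun=> x).
rewrite (pr_cylinder walkX) eqxx big_ord0 !mul1r hit_prob_compl.
have -> : [set t | hit x X n 0 t = false] = ~` [set t | hit x X n 0 t = true].
  by apply/seteqP; split=> t /= /negP /negP; case: (hit _ _ _ _ _).
have -> : pr P (~` [set t | hit x X n 0 t = true]) =
    1 - pr P [set t | hit x X n 0 t = true].
  by rewrite {1}/pr probability_setC// prE.
suff : pr P (cylinder X (fun=> x) 0 `&` [set t | hit x X n 0 t = true]) <=
  pr P [set t | hit x X n 0 t = true] by lra.
apply: pr_le => //.
by apply: measurableI; [exact: (measurable_cylinder walkX)|exact: mh].
Qed.

(** The events of not returning within n steps decrease and keep probability at
least s. *)
Lemma not_recurrent_of_hit_prob x (s : R) : 0 < s ->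
  (forall n, s <= hit_prob x false n x) ->
  (exists dT (T : measurableType dT) (P : probability T R) (X : nat -> T -> V),
     is_random_walk adj c x P X) ->
  ~ recurrent adj c.
Proof.
move=> s0 Hs [dT [T [P [X walkX]]]] rec.
pose F n := [set t | hit x X n 0 t = false].
have mF n : measurable (F n) by exact: measurable_hit walkX _ _ _.
have decF n : F n.+1 `<=` F n.
  move=> t; rewrite /F /= /hit -addn1 iotaD has_cat => /negbT.
  by rewrite negb_or => /andP[/negbTE].
have sF n : s <= pr P (F n).
  apply: le_trans (Hs n) _.
  have := pr_hit_ge x walkX false n 0 (fun=> x).
  rewrite (pr_cylinder walkX) eqxx big_ord0 !mul1r => /le_trans; apply.
  apply: pr_le => //.
  by apply: measurableI; [exact: (measurable_cylinder walkX)|exact: mF].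
have [t Ft [n [n0 Xn]]] := ae_exists (rec x dT T P X walkX)
  (bigcapT_measurable mF) (lt_le_trans s0 (pr_bigcap_ge mF decF sF)).
have := Ft n I; rewrite /F /= /hit => /negP; apply; apply/hasP.
exists n.-1; first by rewrite mem_iota; lia.
by rewrite add0n prednK//; apply/eqP.
Qed.

End Walk.

(** * Random walks on a tree network *)

Section TreeNetwork.
Context (R : realType) (V : choiceType) (o : V) (b : nat) (T : rtree o b).
Local Notation lv := (lv T).
Local Notation par := (par T).
Local Notation ch := (ch T).
Context (adj : rel V) (cnd : {fset V} -> R).
Hypothesis b_gt0 : (0 < b)%N.
Hypothesis adjE : forall x y, adj x y = (y \in ch x) || (x \in ch y).

(** The value 1 at the root, which has no parent edge, makes the positivity of all
conductances hold without a side condition. *)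
Definition edge_cond i := if i == o then 1 else cnd [fset par i; i]%fset.

Lemma edge_condE i : i != o -> edge_cond i = cnd [fset par i; i]%fset.
Proof. by rewrite /edge_cond => /negbTE ->. Qed.

Hypothesis edge_cond_gt0 : forall i, 0 < edge_cond i.

Definition nbr v := if v == o then ch v else par v :: ch v.

Lemma adj_irr : irreflexive adj.
Proof. by move=> x; rewrite adjE orbb; apply/negP => /chP[_ _ /n_Sn]. Qed.

Lemma adj_sym : symmetric adj.
Proof. by move=> x y; rewrite !adjE orbC. Qed.

Lemma nbr_uniq v : uniq (nbr v).
Proof.
rewrite /nbr; case: eqP => vo; first exact: ch_uniq.
rewrite /= ch_uniq andbT; apply/negP => /chP[_ _ lp].
move/eqP: vo => /(lv_par T) lv1; move: lp; rewrite lv1 => /eqP.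
by rewrite -[X in X == _]addn0 -addn2 eqn_add2l.
Qed.

Lemma mem_nbr x y : (y \in nbr x) = adj x y.
Proof.
rewrite adjE /nbr; case: eqVneq => [->|xo].
  by rewrite (mem_ch T y o) eqxx orbF.
by rewrite inE orbC (mem_ch T y x) xo eq_sym.
Qed.

Lemma nbr_neq0 x : nbr x != [::].
Proof.
rewrite /nbr; case: (x == o) => //.
by apply/eqP => chx; have := size_ch T x; rewrite chx /=; lia.
Qed.

Lemma cnd_gt0 x y : adj x y -> 0 < cnd [fset x; y]%fset.
Proof.
rewrite adjE => /orP[|] /chP[io <- _]; first by rewrite -edge_condE//; exact: edge_cond_gt0.
by rewrite fsetUC -edge_condE//; exact: edge_cond_gt0.
Qed.

Lemma net_flow g y :
  \sum_(z <- nbr y) cnd [fset y; z]%fset * (g z - g y) =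
  outflow T edge_cond g y - (if y == o then 0 else edge_cond y * (g y - g (par y))).
Proof.
have E : \sum_(z <- ch y) cnd [fset y; z]%fset * (g z - g y) = outflow T edge_cond g y.
  by apply: eq_big_seq => z /chP[zo pz _]; rewrite edge_condE// pz.
rewrite /nbr; case: eqVneq => yo; first by rewrite E subr0.
by rewrite big_cons E edge_condE// fsetUC; ring.
Qed.

Local Notation tp := (trans_prob adj cnd).
Local Notation mass := (mass nbr cnd).

Lemma mass_pos y : 0 < mass y.
Proof. exact: (mass_gt0 mem_nbr nbr_neq0 cnd_gt0). Qed.

Lemma trans_prob_nbr y z : z \in nbr y -> tp y z = cnd [fset y; z]%fset / mass y.
Proof. exact: (trans_probE _ adj_sym adj_irr nbr_uniq mem_nbr). Qed.

(** The generator of the walk is the divergence of the flow divided by the mass, so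
harmonicity for the walk is [harmonic_at]. *)
Lemma sum_tp_diff (g : V -> R) y :
  \sum_(z <- nbr y) tp y z * g z - g y =
  (outflow T edge_cond g y - (if y == o then 0 else edge_cond y * (g y - g (par y)))) / mass y.
Proof.
rewrite -net_flow mulr_suml -[g y in LHS]mul1r.
rewrite -(sum_trans_prob adj_sym adj_irr nbr_uniq mem_nbr nbr_neq0 cnd_gt0 y).
rewrite mulr_suml -sumrB; apply: eq_big_seq => z zy.
by rewrite trans_prob_nbr//; ring.
Qed.

Section Return.
Variable x : V.
Local Notation q := (hit_prob adj nbr cnd x false).

Lemma hit_prob_false_itv n y : 0 <= q n y <= 1.
Proof. exact: (hit_prob_itv adj_sym adj_irr nbr_uniq mem_nbr nbr_neq0 cnd_gt0). Qed.

Definition never_return y := inf (range (fun n => q n y)).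

Lemma hit_prob_cvg y : q n y @[n --> \oo] --> never_return y.
Proof.
apply: nonincreasing_cvgn.
  move=> m n mn.
  exact: (hit_prob_anti adj_sym adj_irr nbr_uniq mem_nbr nbr_neq0 cnd_gt0).
by exists 0 => _ [n _ <-]; have /andP[] := hit_prob_false_itv n y.
Qed.

(** The probability of never being at x, from time 0 on; [never_return] ignores
time 0 and differs from it only at x. *)
Definition never_hit y := if y == x then 0 else never_return y.

Lemma never_return_step y : never_return y = \sum_(z <- nbr y) tp y z * never_hit z.
Proof.
have H : q n.+1 y @[n --> \oo] --> \sum_(z <- nbr y) tp y z * never_hit z.
  apply: cvg_sum_seq => z; apply: cvgM; first exact: cvg_cst.
  rewrite /never_hit; case: eqP => _; first exact: cvg_cst.
  exact: hit_prob_cvg.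
apply: (cvg_unique _ _ H) => //.
by have := @hit_prob_cvg y; rewrite -(cvg_shiftS (fun n => q n y)).
Qed.

Lemma never_hit_itv y : 0 <= never_hit y <= 1.
Proof.
rewrite /never_hit; case: eqP => _; first by rewrite lexx ler01.
apply/andP; split.
  by apply: (cvgr_to_ge (@hit_prob_cvg y)); apply: nearW => n; have /andP[] := hit_prob_false_itv n y.
by apply: (cvgr_to_le (@hit_prob_cvg y)); apply: nearW => n; have /andP[] := hit_prob_false_itv n y.
Qed.

Lemma never_hit_harmonic y : y != x -> harmonic_at T edge_cond never_hit y.
Proof.
move=> yx; have := sum_tp_diff never_hit y.
rewrite -never_return_step {1}/never_hit (negbTE yx) subrr => /esym/eqP.
by rewrite mulf_eq0 invr_eq0 (gt_eqF (mass_pos y)) orbF subr_eq0 => /eqP.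
Qed.

End Return.

(** By [liouville] the probability of never hitting x is zero from everywhere, hence
so is the probability of never returning to x. *)
Lemma recurrent_of_cutoffs :
  (forall m (e : R), 0 < e -> exists phi N, [/\ (m <= N)%N,
     forall y, (lv y <= m)%N -> phi y = 1,
     forall y, (N <= lv y)%N -> phi y = 0 & energy T edge_cond N o phi <= e]) ->
  recurrent adj cnd.
Proof.
move=> cut.
apply: (recurrent_of_hit_prob adj_sym adj_irr nbr_uniq mem_nbr nbr_neq0 cnd_gt0) => x e e0.
have k0 : forall y, never_hit x y = 0.
  apply: (liouville edge_cond_gt0 (never_hit_itv x) _ (@never_hit_harmonic x) cut).
  by rewrite /never_hit eqxx.
have qx : never_return x x = 0.
  by rewrite never_return_step big1// => z _; rewrite k0 mulr0.
have := @hit_prob_cvg x x; rewrite qx => /cvgr_lt /(_ _ e0)[n _ /(_ n (leqnn n))] H.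
by exists n; apply: ltW.
Qed.

(** A subharmonic function that vanishes at the root and is at most 1 bounds from
below the probability of not hitting the root within n steps, for every n. *)
Lemma not_recurrent_of_subharmonic (h : V -> R) :
  (forall y, 0 <= h y <= 1) -> h o = 0 ->
  (forall y, y != o -> edge_cond y * (h y - h (par y)) <= outflow T edge_cond h y) ->
  0 < outflow T edge_cond h o ->
  (exists dT (W : measurableType dT) (P : probability W R) (X : nat -> W -> V),
     is_random_walk adj cnd o P X) ->
  ~ recurrent adj cnd.
Proof.
move=> hI ho hsub hout; set s := outflow T edge_cond h o / mass o.
have tp0 y z : 0 <= tp y z.
  exact: (trans_prob_ge0 adj_sym adj_irr nbr_uniq mem_nbr nbr_neq0 cnd_gt0).
have sE : s = \sum_(z <- nbr o) tp o z * h z.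
  by have := sum_tp_diff h o; rewrite ho eqxx !subr0 => ->.
have kill_h n y : \sum_(z <- nbr y) tp y z * h z <=
    \sum_(z <- nbr y) tp y z * (if z == o then 0 else h z).
  by apply: ler_sum => z _; case: eqP => // ->; rewrite ho.
have qh n y : y != o -> h y <= hit_prob adj nbr cnd o false n y.
  elim: n y => [|n IH] y yo; first by have /andP[] := hI y.
  apply: le_trans (_ : \sum_(z <- nbr y) tp y z * h z <= _).
    rewrite -subr_ge0 sum_tp_diff (negbTE yo) divr_ge0 ?(ltW (mass_pos y))//.
    by rewrite subr_ge0 hsub.
  apply: ler_sum => z _; rewrite ler_wpM2l//.
  by case: (eqVneq z o) => [->|/IH//]; rewrite ho.
have qs n : s <= hit_prob adj nbr cnd o false n o.
  case: n => [|n].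
    rewrite sE; apply: le_trans (_ : \sum_(z <- nbr o) tp o z <= _).
      by apply: ler_sum => z _; rewrite ler_piMr//; have /andP[] := hI z.
    by rewrite (sum_trans_prob adj_sym adj_irr nbr_uniq mem_nbr nbr_neq0 cnd_gt0).
  rewrite sE; apply: ler_sum => z _; rewrite ler_wpM2l//.
  by case: (eqVneq z o) => [->|/qh//]; rewrite ho.
apply: (not_recurrent_of_hit_prob nbr_uniq _ qs).
by rewrite divr_gt0// mass_pos.
Qed.

End TreeNetwork.

(** * Regular trees are rooted trees *)

Section RegularTree.
Context (V : choiceType) (adj : rel V) (o : V).

Lemma nat_minP (A : set nat) : (exists n, A n) ->
  A (nat_min A) /\ forall m, A m -> (nat_min A <= m)%N.
Proof.
move=> [n An]; have exA : exists n, `[< A n >] by exists n; apply/asboolP.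
case: (ex_minnP exA) => m /asboolP Am mmin.
have H : [set k | A k /\ forall j, A j -> (k <= j)%N] m.
  by split=> // j /asboolP; exact: mmin.
exact: (@xgetPex _ 0%N _ (ex_intro _ m H)).
Qed.

Lemma card_ord_seq (A : set V) d : (A #= [set: 'I_d])%card ->
  exists s : seq V, [/\ uniq s, size s = d & forall y, (y \in s) <-> A y].
Proof.
move=> Ad; have {}Ad : (A #= `I_d)%card by apply: card_eq_trans Ad _; rewrite card_eq_sym card_II.
have fA : finite_set A by apply/finite_setP; exists d.
exists (fset_set A); split.
- exact: fset_uniq.
- by apply/card_eq_fsetP; rewrite fset_setK.
- by move=> y; rewrite in_fset_set// inE.
Qed.

Hypotheses (sym : symmetric adj) (irr : irreflexive adj).
Hypotheses (conn : forall x y, reachable adj x y).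
Hypothesis acyc : forall c : seq V, ucycle adj c -> (size c < 3)%N.

Definition lvl x := gdist adj x o.

Lemma lvlP x : (exists p, [/\ path adj x p, last x p = o & size p = lvl x]) /\
  forall p, path adj x p -> last x p = o -> (lvl x <= size p)%N.
Proof.
have [p pp lp] := conn x o.
have [|H1 H2] := @nat_minP [set n | exists p, [/\ path adj x p, last x p = o & size p = n]].
  by exists (size p), p.
by split=> // q pq lq; apply: H2; exists q.
Qed.

Lemma lvl_root : lvl o = 0%N.
Proof. by have [_ /(_ [::] isT erefl)] := lvlP o; rewrite leqn0 => /eqP. Qed.

Lemma lvl_eq0 x : lvl x = 0%N -> x = o.
Proof.
by move=> lx; have [[p [_ lp sp]] _] := lvlP x; move: sp lp; rewrite lx => /size0nil ->.
Qed.

Lemma lvl_adj x y : adj x y -> (lvl x <= (lvl y).+1)%N.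
Proof.
move=> xy; have [[p [pp lp <-]] _] := lvlP y; have [_ H] := lvlP x.
by apply: (H (y :: p)); rewrite //= xy.
Qed.

Lemma ex_parent x : x != o -> exists y, adj x y /\ lvl x = (lvl y).+1.
Proof.
move=> xo; have [[p [pp lp sp]] _] := lvlP x.
case: p pp lp sp => [_ /= xo'|y p /= /andP[xy pp] lp sp].
  by rewrite xo' eqxx in xo.
exists y; split=> //; apply/eqP; rewrite eqn_leq lvl_adj// -sp ltnS.
by have [_ H] := lvlP y; exact: H.
Qed.

Definition parent x := xget o [set y | adj x y /\ lvl x = (lvl y).+1].

Lemma parentP x : x != o -> adj x (parent x) /\ lvl x = (lvl (parent x)).+1.
Proof. by move=> /ex_parent H; exact: (@xgetPex _ o _ H). Qed.

(** Adjacency outside x. *)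
Definition away x := [rel u v | [&& adj u v, u != x & v != x]].

(** A path from y to y' that avoids x closes up, through x, to a cycle of length at
least 3 unless y = y'. *)
Lemma no_detour x y y' : adj x y -> adj x y' -> reachable (away x) y y' -> y = y'.
Proof.
move=> xy xy' [p pp lp].
have yx : y != x by apply/eqP => yx; rewrite yx irr in xy.
case/shortenP: pp lp => p' pp' up' _ lp'.
have pa : path adj y p'.
  by apply: sub_path pp' => u v /= /and3P[].
have xp : x \notin p'.
  apply/negP => xp; elim: p' y pp' xp {xy lp' pa up' yx} => //= z p' IH y /andP[/and3P[_ _ zx] pp'].
  by rewrite inE eq_sym (negbTE zx) /=; exact: IH pp'.
have := acyc (c := [:: x, y & p']).
rewrite /ucycle /cycle /= rcons_path xy pa lp' sym xy' /= inE negb_or xp eq_sym yx.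
move: up' => /= -> /= /(_ isT); case: p' lp' {pp' pa xp} => //= z p'.
Qed.

Lemma reachable_sym (e : rel V) x y : symmetric e -> reachable e x y ->
  reachable e y x.
Proof.
move=> es [p pp <-]; exists (rev (belast x p)).
  by rewrite rev_path; apply: sub_path pp => u v; rewrite /= es.
by case: p {pp} => //= z p; rewrite rev_cons last_rcons.
Qed.

Lemma reachable_trans (e : rel V) x y z :
  reachable e x y -> reachable e y z -> reachable e x z.
Proof.
move=> [p pp lp] [q pq lq]; exists (p ++ q); first by rewrite cat_path pp lp.
by rewrite last_cat lp.
Qed.

(** Going from parent to parent the level decreases, so x, which is not below y, is
never met. *)
Lemma away_root x y : y != x -> (lvl y <= lvl x)%N -> reachable (away x) y o.
Proof.
elim: {y}(lvl y) {-2}y (erefl (lvl y)) => [|k IH] y ly yx lyx.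
  by rewrite (lvl_eq0 ly); exists [::].
have yo : y != o by apply/eqP => yo; rewrite yo lvl_root in ly.
have [ayp lp] := parentP yo.
have px : parent y != x by apply/eqP => px; move: lp lyx; rewrite px => ->; rewrite ltnn.
apply: reachable_trans (IH (parent y) _ px _); last 2 first.
- by move: lp; rewrite ly => -[].
- by rewrite (leq_trans _ lyx)// lp.
by exists [:: parent y] => //=; rewrite ayp yx px.
Qed.

(** Two neighbours of x that are not farther from the root than x are joined,
through the root, by a path that avoids x. This excludes both a second parent
and a neighbour at the same level. *)
Lemma parent_unique x y : adj x y -> (lvl y <= lvl x)%N -> x != o /\ parent x = y.
Proof.
have aw y' : adj x y' -> (lvl y' <= lvl x)%N -> reachable (away x) y' o.
  by move=> xy' l; apply: away_root => //; apply/eqP => e; rewrite e irr in xy'.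
move=> xy lyx.
have xo : x != o.
  apply/eqP => xo; move: lyx; rewrite xo lvl_root leqn0 => /eqP /lvl_eq0 yo.
  by rewrite xo yo irr in xy.
split=> //; have [xp lp] := parentP xo.
apply: (no_detour xp xy); apply: reachable_trans (aw _ xp _) _; first by rewrite lp.
apply: reachable_sym (aw _ xy lyx) => u v /=.
by rewrite sym; case: (u != x); case: (v != x).
Qed.

Lemma rtree_of_regular d : (0 < d)%N ->
  (forall x : V, [set y | adj x y] #= [set: 'I_d])%card ->
  exists T : rtree o d.-1,
    (forall x y, adj x y = (y \in ch T x) || (x \in ch T y)) /\
    (forall x, gdist adj x o = lv T x).
Proof.
move=> d0 reg.
have /choice[nb nbP] : forall x, exists s : seq V,
    [/\ uniq s, size s = d & forall y, (y \in s) <-> adj x y].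
  by move=> x; exact: card_ord_seq (reg x).
pose ch x := [seq y <- nb x | (lvl x < lvl y)%N].
have chE v i : (i \in ch v) = (i != o) && (parent i == v).
  rewrite mem_filter; apply/andP/andP => -[H1 H2].
    have [_ _ /(_ i)[/(_ H2) vi _]] := nbP v.
    have [-> ->] : i != o /\ parent i = v by apply: parent_unique; rewrite 1?sym// ltnW.
    by [].
  have [ip lp] := parentP H1; move/eqP: H2 => pv; rewrite pv in ip lp.
  rewrite lp ltnSn; split=> //; have [_ _ ->] := nbP v; by rewrite sym.
have chu v : uniq (ch v) by rewrite filter_uniq//; have [] := nbP v.
have chs v : size (ch v) = ((v == o) + d.-1)%N.
  have [nu ns nm] := nbP v.
  rewrite size_filter; have := count_predC (fun y => (lvl v < lvl y)%N) (nb v).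
  rewrite ns; suff : count (predC (fun y => (lvl v < lvl y)%N)) (nb v) = (v != o).
    by move=> ->; case: (v == o) => /=; lia.
  rewrite -size_filter; case: eqP => [->|/eqP vo] /=.
    have [_ _ no] := nbP o.
    apply/eqP; rewrite size_filter -leqn0 leqNgt -has_count; apply/hasPn => y.
    move=> /no oy /=; rewrite negbK lvl_root lt0n; apply/eqP => /lvl_eq0 yo.
    by rewrite yo irr in oy.
  have [vp lp] := parentP vo.
  rewrite -[RHS]/(size [:: parent v]); apply: perm_size; apply: uniq_perm => //.
    by rewrite filter_uniq.
  move=> y; rewrite mem_filter mem_seq1 /= -leqNgt; apply/andP/eqP => [[ly /nm vy]|->].
    by have [_ ->] := parent_unique vy ly.
  by split; [rewrite lp|apply/nm].
have lpar i : i != o -> lvl i = (lvl (parent i)).+1 by move=> /parentP[].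
exists (RTree chu chE lvl_root lpar chs); split=> // x y /=.
rewrite !chE; apply/idP/orP.
  move=> xy; have [yx|xy'] := leqP (lvl y) (lvl x).
    by right; have [-> ->] := parent_unique xy yx; rewrite eqxx.
  left; have [] := @parent_unique y x; rewrite 1?sym// 1?ltnW// => -> ->.
  by rewrite eqxx.
by move=> [|] /andP[/parentP[] + _ /eqP <-] //; rewrite sym.
Qed.

End RegularTree.

(** * Uniform edge labels and open edges *)

Section Uniform.
Context (R : realType).
Local Notation unif := (uniform_prob (@ltr01 R)).

Lemma measurable_le (a : R) : measurable [set u : R | u <= a].
Proof.
by have := measurable_itv (`]-oo, a] : interval R); rewrite set_itvE.
Qed.

Lemma unif_le (a : R) : 0 <= a <= 1 -> pr unif [set u | u <= a] = a.
Proof.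
move=> /andP[a0 a1]; rewrite /pr.
suff H : uniform_prob (@ltr01 R) [set u | u <= a] = a%:E by exact: (congr1 fine H).
rewrite /uniform_prob integral_uniform_pdf.
have -> : [set u | u <= a] `&` `[0, 1] = `[0, a]%classic.
  apply/seteqP; split=> u /=; rewrite !in_itv /=.
    by move=> [-> /andP[-> _]].
  by move=> /andP[-> ua]; rewrite ua (le_trans ua).
rewrite (eq_integral (fun=> 1%:E)); last first.
  move=> u; rewrite inE /= in_itv /= => /andP[u0 ua].
  by rewrite /uniform_pdf u0 (le_trans ua a1) subr0 invr1.
rewrite integral_cst//= mul1e lebesgue_measure_itv /= lte_fin.
case: ltP => a0'; first by rewrite sube0.
by have -> : a = 0 by apply/eqP; rewrite eq_le a0 a0'.
Qed.

Lemma unif_gt (a : R) : 0 <= a <= 1 -> pr unif (~` [set u | u <= a]) = 1 - a.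
Proof.
move=> aI; rewrite -[in RHS](unif_le aI) {1}/pr probability_setC ?prE//.
all: exact: measurable_le.
Qed.

End Uniform.

Section Edges.
Context (R : realType) (V : choiceType) (o : V) (b : nat) (T : rtree o b).
Local Notation lv := (lv T).
Local Notation par := (par T).
Local Notation ch := (ch T).
Context (adj : rel V).
Hypothesis adjE : forall x y, adj x y = (y \in ch x) || (x \in ch y).
Context (dW : measure_display) (W : measurableType dW) (P : probability W R).
Context (U : {fset V} -> {RV P >-> R}).
Hypothesis iidU : iid_uniform adj U.
Local Notation unif := (uniform_prob (@ltr01 R)).

Definition uedge i := [fset par i; i]%fset.

Lemma uedge_inj i j : i != o -> j != o -> uedge i = uedge j -> i = j.
Proof.
move=> io jo e; have := lv_par T io; have := lv_par T jo.
have : i \in uedge j by rewrite -e !inE eqxx orbT.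
have : j \in uedge i by rewrite e !inE eqxx orbT.
rewrite !inE => /orP[/eqP ji|/eqP ->//] /orP[/eqP ij|/eqP ->//].
by rewrite -ij -ji; lia.
Qed.

Lemma edges_uedge i : i != o -> edges adj (uedge i).
Proof. by move=> io; exists (par i), i; split=> //; rewrite adjE mem_ch io eqxx. Qed.

Lemma measurable_U i (A : set R) : measurable A ->
  measurable [set w | A (U (uedge i) w)].
Proof.
by move=> mA; rewrite -[X in measurable X]setTI; exact: measurable_funP.
Qed.

Lemma measurable_all_U (s : seq V) (A : V -> set R) : (forall i, measurable (A i)) ->
  measurable [set w | forall i, i \in s -> A i (U (uedge i) w)].
Proof.
move=> mA; rewrite (_ : mkset _ =
  \bigcap_(i in [set` s]) [set w | A i (U (uedge i) w)]).
  by apply: fin_bigcap_measurable => [|i _]; [exact: finite_seq|exact: measurable_U].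
by apply/seteqP; split.
Qed.

(** Independence, restated for edges indexed by their lower endpoints: this index is
faithful, so distinct vertices carry independent labels. *)
Lemma pr_all_U (s : seq V) (A : V -> set R) : uniq s -> o \notin s ->
  (forall i, measurable (A i)) ->
  pr P [set w | forall i, i \in s -> A i (U (uedge i) w)] =
  \prod_(i <- s) pr unif (A i).
Proof.
move=> us os mA.
have so i : i \in s -> i != o by move=> is_; apply: contraNneq os => <-.
pose A' e := \bigcap_(i in [set i | i \in s /\ uedge i = e]) A i.
have A'E i : i \in s -> A' (uedge i) = A i.
  move=> is_; apply/seteqP; split=> u; first by apply; split.
  by move=> Au j [js /uedge_inj ->//]; exact: so.
have -> : [set w | forall i, i \in s -> A i (U (uedge i) w)] =
    [set w | forall e, e \in [fset uedge i | i in s]%fset -> A' e (U e w)].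
  apply/seteqP; split=> w /= H.
    by move=> e /imfsetP[i /= is_ ->]; rewrite A'E//; exact: H.
  by move=> i is_; rewrite -A'E//; apply: H; apply/imfsetP; exists i.
have [U1 U2] := iidU.
rewrite {1}/pr U2; last 2 first.
- by move=> e /imfsetP[i /= is_ ->]; apply: edges_uedge; exact: so.
- by move=> e /imfsetP[i /= is_ ->]; rewrite A'E.
have pm : perm_eq (enum_fset [fset uedge i | i in s]%fset) (map uedge s).
  apply: uniq_perm; first exact: fset_uniq.
    rewrite map_inj_in_uniq// => i j /so io /so jo; exact: uedge_inj.
  by move=> e; apply/imfsetP/mapP => -[i is_ ->]; exists i.
rewrite (perm_big _ pm) big_map.
rewrite (eq_big_seq (fun i => (pr unif (A i))%:E)); last first.
  move=> i is_; rewrite A'E// -prE; last exact: mA.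
  by apply: (U1 (uedge i) (A i)) => //; apply: edges_uedge; exact: so.
by rewrite prodEFin.
Qed.

Definition open_at (p : R) (w : W) i := U (uedge i) w <= p.

Section Bits.
Variable p : R.
Hypothesis pI : 0 <= p <= 1.

Definition agree (t : seq V) (a : V -> bool) :=
  [set w | forall i, i \in t -> open_at p w i = a i].

Lemma agreeE t a : agree t a = [set w | forall i, i \in t ->
  (if a i then [set u : R | u <= p] else ~` [set u | u <= p]) (U (uedge i) w)].
Proof.
apply/seteqP; split=> w H i /H; rewrite /open_at; case: (a i) => //.
  by move/negbT/negP.
by move/negP/negbTE.
Qed.

Lemma measurable_ifle (c : bool) :
  measurable (if c then [set u : R | u <= p] else ~` [set u | u <= p]).
Proof. by case: c; [exact: measurable_le|apply: measurableC; exact: measurable_le]. Qed.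

Lemma measurable_open_at i : measurable [set w | open_at p w i].
Proof. exact: (measurable_U i (measurable_le p)). Qed.

Lemma measurable_agree t a : measurable (agree t a).
Proof.
rewrite agreeE; exact: (measurable_all_U t (fun i => measurable_ifle (a i))).
Qed.

Lemma pr_agree t a : uniq t -> o \notin t ->
  pr P (agree t a) = \prod_(i <- t) (if a i then p else 1 - p).
Proof.
move=> ut ot; rewrite agreeE (pr_all_U ut ot (fun i => measurable_ifle (a i))).
by apply: eq_bigr => i _; case: (a i); [exact: unif_le|exact: unif_gt].
Qed.

Lemma set_bit_open_at w i (B : (V -> bool) -> bool) :
  B (open_at p w) = B (set_bit (open_at p w) i (open_at p w i)).
Proof. by congr B; apply/funext => j; rewrite /set_bit; case: eqP => [->|]. Qed.

Lemma measurable_bits s (B : (V -> bool) -> bool) : depends s B ->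
  measurable [set w | B (open_at p w)].
Proof.
elim: s B => [|i s IH] B dB.
  rewrite (_ : mkset _ = if B (fun=> false) then setT else set0); first by case: ifP.
  by apply/seteqP; split=> w /=; rewrite (dB (open_at p w) (fun=> false))//; case: (B _).
rewrite (_ : mkset _ =
  ([set w | open_at p w i] `&` [set w | B (set_bit (open_at p w) i true)]) `|`
  ((~` [set w | open_at p w i]) `&` [set w | B (set_bit (open_at p w) i false)])).
  have mB c := IH _ (depends_set_bit c dB).
  have mi := measurable_open_at i.
  apply: measurableU; apply: measurableI; [exact: mi|exact: mB| |exact: mB].
  exact: measurableC.
apply/seteqP; split=> w /=; rewrite (set_bit_open_at w i B).
  by case: (boolP (open_at p w i)) => H HB; [left|right; split=> //; exact/negP].
by case=> -[] => [->|/negP/negbTE ->].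
Qed.

(** The extra cylinder event on t is what makes the induction go through: exposing
the bit at i moves i from s to t. *)
Lemma pr_agree_bits s t a (B : (V -> bool) -> bool) : uniq (s ++ t) ->
  o \notin s ++ t ->
  depends s B ->
  pr P (agree t a `&` [set w | B (open_at p w)]) =
  (\prod_(i <- t) (if a i then p else 1 - p)) * bit_expect p s (fun O => (B O)%:R).
Proof.
elim: s t a B => [|i s IH] t a B /=.
  move=> ut ot dB; rewrite -pr_agree//.
  have -> : [set w | B (open_at p w)] = if B (fun=> false) then setT else set0.
    by apply/seteqP; split=> w /=; rewrite (dB (open_at p w) (fun=> false))//; case: (B _).
  by case: ifP; rewrite ?setIT ?mulr1// setI0 mulr0 /pr measure0.
rewrite mem_cat negb_or inE negb_or => /andP[/andP[is_ it] u] /andP[oi ot] dB.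
have key c : pr P (agree t a `&` [set w | B (open_at p w)] `&` [set w | open_at p w i = c]) =
    (\prod_(j <- t) (if a j then p else 1 - p)) *
    ((if c then p else 1 - p) * bit_expect p s (fun O => (B (set_bit O i c))%:R)).
  have u' : uniq (s ++ i :: t).
    by rewrite -cat1s uniq_catCA /= mem_cat negb_or is_ it u.
  have o' : o \notin s ++ i :: t.
    by rewrite mem_cat inE orbCA -mem_cat negb_or oi.
  have := IH (i :: t) (set_bit a i c) _ u' o' (depends_set_bit c dB).
  rewrite big_cons (_ : set_bit a i c i = c); last by rewrite /set_bit eqxx.
  have -> : \prod_(j <- t) (if set_bit a i c j then p else 1 - p) =
      \prod_(j <- t) (if a j then p else 1 - p).
    apply: eq_big_seq => j jt; rewrite /set_bit; case: eqP => // ji.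
    by rewrite -ji jt in it.
  rewrite mulrCA mulrA => <-.
  congr (pr P _); apply/seteqP; split=> w /=.
      move=> [[Ha HB] Hi]; split; last by rewrite -Hi -set_bit_open_at.
      move=> j; rewrite inE /set_bit; case: eqP => [->//|_ /= jt]; exact: Ha.
    move=> [Ha HB]; have Hi : open_at p w i = c by rewrite Ha ?mem_head// /set_bit eqxx.
    split=> //; split; last by rewrite (set_bit_open_at w i B) Hi.
    move=> j jt; rewrite Ha ?inE ?jt ?orbT// /set_bit; case: eqP => // ji.
    by rewrite -ji jt in it.
have mA : measurable (agree t a `&` [set w | B (open_at p w)]).
  by apply: measurableI; [exact: measurable_agree|exact: measurable_bits dB].
rewrite (pr_DI _ mA (measurable_open_at i)) addrC mulrDr.
rewrite -(key true) -(key false); congr (pr P _ + pr P _).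
by rewrite setDE; congr (_ `&` _); apply/seteqP; split=> w /=; [move/negP/negbTE|move=> ->].
Qed.

Lemma pr_bits s (B : (V -> bool) -> bool) : uniq s -> o \notin s -> depends s B ->
  pr P [set w | B (open_at p w)] = bit_expect p s (fun O => (B O)%:R).
Proof.
move=> us os dB; have := @pr_agree_bits s [::] (fun=> false) B.
rewrite cats0 big_nil mul1r => <-//.
by rewrite (_ : agree _ _ = setT) ?setTI//; apply/seteqP; split.
Qed.

Section Markov.
Variables (s : seq V) (F : (V -> bool) -> R).
Hypotheses (us : uniq s) (os : o \notin s) (dF : depends s F).

Lemma depends_le e : depends s (fun O => e <= F O).
Proof. by move=> O O' /dF ->. Qed.

(** Markov's inequality, on the finite side of [pr_bits]. *)
Lemma markov_bits e : 0 < e -> (forall O, 0 <= F O) ->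
  pr P [set w | e <= F (open_at p w)] <= e^-1 * bit_expect p s F.
Proof.
move=> e0 F0; rewrite (pr_bits us os (@depends_le e)) -bit_expectZ.
apply: bit_expect_le => // O; case: (lerP e (F O)) => H.
  by rewrite mulrC ler_pdivlMr// mul1r.
by rewrite mulr_ge0// invr_ge0 ltW.
Qed.

(** From F <= 1_(e <= F) + e: a function bounded by 1 with mean at least 2 e is at
least e with probability at least e. *)
Lemma reverse_markov_bits e : (forall O, F O <= 1) -> 2 * e <= bit_expect p s F ->
  0 <= e ->
  e <= pr P [set w | e <= F (open_at p w)].
Proof.
move=> F1 eF e0; rewrite (pr_bits us os (@depends_le e)).
suff : bit_expect p s F <= bit_expect p s (fun O => (e <= F O)%R%:R) + e by lra.
rewrite -[X in _ + X](@bit_expect_cst R V p s e) -bit_expectD; apply: bit_expect_le => // O.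
case: (lerP e (F O)) => H; last by rewrite add0r ltW.
by rewrite (le_trans (F1 O))// lerDl.
Qed.

End Markov.

End Bits.

End Edges.

(** * A random walk driven by the edge labels *)

Section Sampling.
Context (R : realType) (V : choiceType) (q : V -> R).
Local Notation unif := (uniform_prob (@ltr01 R)).

(** Inverse transform sampling: z is chosen when u lies in an interval of length
q z. The default z0 carries the last element, so that the result is always in
the list when it is nonempty, whatever u is. *)
Fixpoint sample (l : seq V) (z0 : V) (acc u : R) : V :=
  if l is z :: l' then if u <= acc + q z then z else sample l' z (acc + q z) u
  else z0.

Lemma sample_in l z0 acc u : sample l z0 acc u \in z0 :: l.
Proof.
elim: l z0 acc => [|z l IH] z0 acc /=; first exact: mem_head.
by case: ifP => _; rewrite inE ?IH ?mem_head orbT.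
Qed.

Lemma measurable_sample l z0 acc y : measurable [set u | sample l z0 acc u = y].
Proof.
elim: l z0 acc => [|z l IH] z0 acc.
  have [zy|zy] := eqVneq z0 y.
    by rewrite (_ : mkset _ = setT)//; apply/seteqP; split.
  by rewrite (_ : mkset _ = set0)//; apply/seteqP; split=> // u /eqP; rewrite (negbTE zy).
rewrite (_ : mkset _ =
  ([set u | u <= acc + q z] `&` (if z == y then setT else set0)) `|`
  (~` [set u | u <= acc + q z] `&` [set u | sample l z (acc + q z) u = y])).
  have mle := measurable_le (acc + q z).
  apply: measurableU; apply: measurableI; [exact: mle| | |exact: IH].
    by case: ifP.
  exact: measurableC.
apply/seteqP; split=> u /=.
  by case: ifP => [H ->|/negbT/negP H ?]; [left; rewrite eqxx|right].
case=> [[->]|[/negP/negbTE -> //]].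
by case: eqP.
Qed.

(** The labels u above acc are those left over by the elements already passed, whose
total weight is acc. *)
Lemma pr_sample_aux l z0 acc y : uniq l -> (forall z, z \in l -> 0 <= q z) ->
  0 <= acc -> acc + \sum_(z <- l) q z = 1 ->
  pr unif (~` [set u | u <= acc] `&` [set u | sample l z0 acc u = y]) =
  if y \in l then q y else 0.
Proof.
elim: l z0 acc => [|z l IH] z0 acc ul q0 acc0 qs.
  rewrite big_nil addr0 in qs; apply/eqP; rewrite eq_le pr_ge0 andbT.
  apply: le_trans (_ : pr unif (~` [set u | u <= acc]) <= _).
    have m1 := measurableC (measurable_le acc).
    apply: pr_le => //; apply: measurableI => //; exact: measurable_sample.
  by rewrite unif_gt ?qs ?subrr// lexx ler01.
have qz : 0 <= q z by rewrite q0 ?mem_head.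
have q0' x : x \in l -> 0 <= q x by move=> xl; rewrite q0// inE xl orbT.
have qs0 : 0 <= \sum_(x <- l) q x by rewrite big_seq; apply: sumr_ge0.
rewrite big_cons addrA in qs.
set a' := acc + q z in qs *.
have ml := measurable_le acc; have ml' := measurable_le a'.
have mA : measurable (~` [set u | u <= acc] `&` [set u | sample (z :: l) z0 acc u = y]).
  by apply: measurableI; [exact: measurableC|exact: measurable_sample].
have a'1 : a' <= 1 by rewrite -qs lerDl.
have aa' : acc <= a' by rewrite lerDl.
rewrite (pr_DI unif mA ml').
have -> : ~` [set u | u <= acc] `&` [set u | sample (z :: l) z0 acc u = y]
   `\` [set u | u <= a'] =
  ~` [set u | u <= a'] `&` [set u | sample l z a' u = y].
  apply/seteqP; split=> u /=; rewrite -/a'.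
    by move=> [[_ +] /negP/negbTE H]; rewrite H.
  move=> [/negP/negbTE H1 H2]; rewrite H1; split; last by apply/negP.
  by split=> //; apply/negP; rewrite -ltNge (le_lt_trans aa')// ltNge H1.
have /andP[zl ul'] : (z \notin l) && uniq l by [].
rewrite IH//; last by rewrite (le_trans acc0).
have -> : ~` [set u | u <= acc] `&` [set u | sample (z :: l) z0 acc u = y]
   `&` [set u | u <= a'] =
  if z == y then [set u | u <= a'] `\` [set u | u <= acc] else set0.
  apply/seteqP; split=> u /=; rewrite -/a'.
    by move=> [[H1 +] H2]; rewrite H2 => ->; rewrite eqxx.
  by case: eqP => // zy [H1 H2]; rewrite H1.
have Hab : pr unif ([set u | u <= a'] `\` [set u | u <= acc]) = q z.
  have := pr_DI unif ml' ml.
  have -> : [set u | u <= a'] `&` [set u | u <= acc] = [set u | u <= acc].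
    by apply/seteqP; split=> u /= => [[]//|ua]; split=> //; exact: le_trans aa'.
  rewrite !unif_le ?acc0 ?(le_trans acc0 aa') ?(le_trans aa' a'1)//.
  by rewrite /a'; lra.
rewrite inE [y == z]eq_sym; case: (eqVneq z y) => [zy|_] /=.
  by rewrite -zy (negbTE zl) add0r Hab.
by rewrite /pr measure0 addr0.
Qed.

Lemma pr_sample l z0 y : uniq l -> (forall z, z \in l -> 0 <= q z) ->
  \sum_(z <- l) q z = 1 ->
  pr unif [set u | sample l z0 0 u = y] = if y \in l then q y else 0.
Proof.
move=> ul q0 qs; rewrite -(@pr_sample_aux l z0 0 y) ?add0r//.
have mA := measurable_sample l z0 0 y; have m0 := measurable_le (0 : R).
rewrite (pr_DI unif mA m0) setDE setIC [X in _ + X](_ : _ = 0) ?addr0//.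
apply/eqP; rewrite eq_le pr_ge0 andbT.
rewrite -[leRHS](@unif_le R 0) ?lexx ?ler01//.
by apply: pr_le => //; exact: measurableI.
Qed.

End Sampling.

Section WalkExists.
Context (R : realType) (V : choiceType) (o : V) (b : nat) (T : rtree o b).
Local Notation lv := (lv T).
Local Notation par := (par T).
Local Notation ch := (ch T).
Context (adj : rel V) (cnd : {fset V} -> R).
Hypothesis b_gt0 : (0 < b)%N.
Hypothesis adjE : forall x y, adj x y = (y \in ch x) || (x \in ch y).
Hypothesis edge_cond_gt0 : forall i, 0 < edge_cond T cnd i.
Context (dW : measure_display) (W : measurableType dW) (P : probability W R).
Context (U : {fset V} -> {RV P >-> R}).
Hypothesis iidU : iid_uniform adj U.
Local Notation unif := (uniform_prob (@ltr01 R)).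
Local Notation nbr := (nbr T).
Local Notation tp := (trans_prob adj cnd).
Local Notation uedge := (uedge T).

(** The edges of an infinite descending path are distinct, hence their labels are i.i.d. *)
Fixpoint ray n := if n is n'.+1 then head o (ch (ray n')) else o.

Lemma ray_child n : ray n.+1 \in ch (ray n).
Proof.
rewrite /= ; have := size_ch T (ray n); case: (ch (ray n)) => [|z l] /=; first by lia.
by rewrite mem_head.
Qed.

Lemma lv_ray n : lv (ray n) = n.
Proof.
elim: n => [|n IH]; first exact: lv_root.
by have [_ _ ->] := chP (ray_child n); rewrite IH.
Qed.

Definition walk_step v u := sample (tp v) (nbr v) v 0 u.

(** The n-th step uses the label of the n-th edge of the ray. *)
Fixpoint walk x0 n w :=
  if n is n'.+1 then walk_step (walk x0 n' w) (U (uedge (ray n'.+1)) w) else x0.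

Lemma measurable_walk_step v y : measurable [set u | walk_step v u = y].
Proof. exact: measurable_sample. Qed.

Lemma pr_walk_step v y : pr unif [set u | walk_step v u = y] = tp v y.
Proof.
rewrite pr_sample.
- rewrite (mem_nbr adjE); case: ifP => // vy.
  by rewrite /trans_prob vy.
- exact: nbr_uniq.
- move=> z _; exact: (trans_prob_ge0 (adj_sym adjE) (adj_irr adjE) (nbr_uniq T)
    (mem_nbr adjE) (nbr_neq0 T b_gt0) (cnd_gt0 adjE edge_cond_gt0)).
- exact: (sum_trans_prob (adj_sym adjE) (adj_irr adjE) (nbr_uniq T)
    (mem_nbr adjE) (nbr_neq0 T b_gt0) (cnd_gt0 adjE edge_cond_gt0)).
Qed.

Lemma walk_step_nbr v u : v \in nbr (walk_step v u).
Proof.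
rewrite (mem_nbr adjE) (adj_sym adjE) -(mem_nbr adjE).
rewrite /walk_step; have := nbr_neq0 T b_gt0 v; case: (nbr v) => [//|z l] _ /=.
by case: ifP => _; [exact: mem_head|exact: sample_in].
Qed.

Lemma measurable_walk x0 n y : measurable (walk x0 n @^-1` [set y]).
Proof.
elim: n y => [|n IH] y.
  have [xy|xy] := eqVneq x0 y.
    by rewrite (_ : _ @^-1` _ = setT)//; apply/seteqP; split.
  by rewrite (_ : _ @^-1` _ = set0)//; apply/seteqP; split=> // w /eqP; rewrite (negbTE xy).
rewrite (_ : _ @^-1` _ = \bigcup_(v in [set` nbr y])
  ((walk x0 n @^-1` [set v]) `&` [set w | walk_step v (U (uedge (ray n.+1)) w) = y])).
  apply: fin_bigcup_measurable; first exact: finite_seq.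
  move=> v _; apply: measurableI; first exact: IH.
  exact: (measurable_U T U (ray n.+1) (measurable_walk_step v y)).
apply/seteqP; split=> w /=.
  move=> Xy; exists (walk x0 n w) => /=; last by [].
  by rewrite -Xy; exact: walk_step_nbr.
by move=> [v _ [/= <-]].
Qed.

Lemma walk_is_random_walk x0 : is_random_walk adj cnd x0 P (walk x0).
Proof.
split; first exact: measurable_walk.
move=> n z.
have [zx|zx] := eqVneq (z 0%N) x0; last first.
  rewrite mul0r (_ : mkset _ = set0) ?measure0//; apply/seteqP; split=> // w /= H.
  by move: zx; rewrite -(H 0%N (leq0n _)) eqxx.
rewrite mul1r.
pose A i := [set u : R | walk_step (z (lv i).-1) u = z (lv i)].
(* The k-th step uses the label at [ray k.+1], whose level k.+1 recovers k. *)
pose s := [seq ray k.+1 | k <- iota 0 n].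
have mA i : measurable (A i) by exact: measurable_walk_step.
have us : uniq s.
  rewrite map_inj_uniq ?iota_uniq// => i j /(congr1 lv); rewrite !lv_ray; lia.
have os : o \notin s.
  by apply/mapP => -[k _ /(congr1 lv)]; rewrite lv_ray lv_root.
have E : [set w | forall k, (k <= n)%N -> walk x0 k w = z k] =
    [set w | forall i, i \in s -> A i (U (uedge i) w)].
  apply/seteqP; split=> w /= H.
    move=> i /mapP[k]; rewrite mem_iota add0n => /andP[_ kn] ->.
    by rewrite /A lv_ray succnK -(H k.+1 kn) -(H k (ltnW kn)).
  elim=> [|k IH] kn; first by rewrite zx.
  rewrite /= IH ?(ltnW kn)//.
  have := H (ray k.+1); rewrite /A lv_ray; apply.
  by apply: (map_f (fun k => ray k.+1)); rewrite mem_iota.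
rewrite E prE; last exact: measurable_all_U.
rewrite (pr_all_U adjE iidU us os mA) /s big_map -(big_mkord xpredT (fun k => tp (z k) (z k.+1))).
rewrite /index_iota subn0; congr EFin; apply: eq_bigr => k _.
by rewrite /A lv_ray pr_walk_step.
Qed.

End WalkExists.

(** * Open clusters *)

Section Clusters.
Context (V : choiceType) (o : V) (b : nat) (T : rtree o b).
Local Notation lv := (lv T).
Local Notation par := (par T).
Local Notation ch := (ch T).

Fixpoint level_ball n :=
  if n is n'.+1 then level_ball n' ++ flatten [seq ch v | v <- level_ball n'] else [:: o].

Lemma mem_level_ball n y : (lv y <= n)%N -> y \in level_ball n.
Proof.
elim: n y => [|n IH] y.
  by rewrite leqn0 -root_lv0 => /eqP ->; exact: mem_head.
move=> yn /=; rewrite mem_cat; case: (leqP (lv y) n) => [/IH -> //|ny].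
have yo : y != o by rewrite (root_lv0 T); lia.
apply/orP; right; apply/flatten_mapP; exists (par y); last by rewrite mem_ch yo eqxx.
by apply: IH; move: (lv_par T yo); lia.
Qed.

Lemma alive_par O m y : (m < lv y)%N -> alive T O m y -> alive T O m (par y).
Proof.
move=> my; have yo : y != o by rewrite (root_lv0 T); lia.
by rewrite alive_child// => /andP[].
Qed.

Lemma lv_iter_par n y : (n <= lv y)%N -> lv (iter n par y) = (lv y - n)%N.
Proof.
elim: n => [|n IH] ny; first by rewrite subn0.
have ln := IH (ltnW ny).
have yo : iter n par y != o by rewrite (root_lv0 T) ln; lia.
by move: (lv_par T yo); rewrite iterS ln; lia.
Qed.

Lemma alive_iter O m n y : (m + n <= lv y)%N -> alive T O m y ->
  alive T O m (iter n par y).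
Proof.
elim: n => [//|n IH] mny ay; apply: alive_par; last by apply: IH => //; lia.
by rewrite lv_iter_par; lia.
Qed.

(** A single open path of length n suffices for survival with lam = 1. *)
Lemma survival_alive (R : realType) O m n y : (lv y = m + n)%N -> alive T O m y ->
  survival T (1 : R) n (iter n par y) O = 1.
Proof.
elim: n m => [|n IH] m ly ay //.
have ay' : alive T O m.+1 y.
  rewrite /alive; apply/allP => k; rewrite mem_iota => kr.
  by move/allP: ay => /(_ k); apply; rewrite mem_iota; lia.
have Oi : O (iter n par y).
  by move/allP: ay => /(_ n); apply; rewrite mem_iota; lia.
have lyS : (lv y = m.+1 + n)%N by lia.
have li : lv (iter n par y) = m.+1 by rewrite lv_iter_par; lia.
have io : iter n par y != o by rewrite (root_lv0 T) li.
have iv : iter n par y \in ch (iter n.+1 par y) by rewrite mem_ch io iterS eqxx.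
have [s0|//] := survival1_bool R T n.+1 (iter n.+1 par y) O.
have := survival1_eq0 s0 iv Oi; rewrite (IH m.+1 lyS ay') => /eqP.
by rewrite oner_eq0.
Qed.

(** The terms are indicators, so a sum below 1 vanishes. *)
Lemma level_sum_extinct (R : realType) (lam : R) n j v O :
  level_sum T (survival T (1 : R) n) j v O < 1 -> level_sum T (path_weight T lam n) j v O = 0.
Proof.
elim: j v => [|j IH] v /=.
  move=> s1; apply: path_weight_survival1; case: (survival1_bool R T n v O) => // s1'.
  by rewrite s1' ltxx in s1.
move=> s1; rewrite big_seq big1// => i iv; apply: IH; apply: le_lt_trans s1.
rewrite (big_rem i iv)/= lerDl sumr_ge0// => k _; apply: level_sum_ge0 => u.
by have /andP[] := survival_itv T n u O (lexx (1 : R)).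
Qed.

Lemma survival_reach (R : realType) (lam : R) (e : rel V) (O : V -> bool) n v :
  (forall i, i != o -> O i -> e (par i) i) ->
  survival T lam n v O != 0 -> exists2 y, reachable e v y & lv y = (lv v + n)%N.
Proof.
move=> Oe; elim: n v => [|n IH] v.
  by move=> _; exists v; [exists [::]|rewrite addn0].
move=> sv; have [i iv /andP[Oi si]] : exists2 i, i \in ch v & O i && (survival T lam n i O != 0).
  apply: contrapT => H; move/eqP: sv; apply; rewrite /survival -/(survival T lam).
  rewrite big_seq big1 ?subrr// => i iv.
  case: (boolP (O i)) => Oi; last by rewrite !mul0r subr0.
  case: (eqVneq (survival T lam n i O) 0) => [->|si]; first by rewrite mulr0 mul0r subr0.
  by exfalso; apply: H; exists i => //; rewrite Oi.
have [io pi li] := chP iv; have [y ry ly] := IH i si.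
exists y; last by rewrite ly li addSnnS.
apply: reachable_trans ry; exists [:: i] => //=.
by rewrite -pi Oe.
Qed.

(** Let m be one more than the level of x. Along an open path from x, the edges from
the current vertex up to level m stay open: a step down adds an open edge, a
step up removes one. As no open path of length n starts at level m, the cluster
has no vertex at level m + n or beyond. *)
Lemma finite_extinct_cluster (R : realType) (e : rel V) (O : V -> bool) x :
  (forall y z, e y z -> (z \in ch y /\ O z) \/ y \in ch z) ->
  (forall m, (0 < m)%N -> exists n, level_sum T (survival T (1 : R) n) m o O < 1) ->
  finite_set [set y | reachable e x y].
Proof.
move=> eO ext; pose m := (lv x).+1.
have [n Hn] := ext m (ltn0Sn _).
have along p : forall x', path e x' p -> alive T O m x' -> alive T O m (last x' p).
  elim: p => //= z p IH y /andP[yz pp] ay.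
  apply: IH pp _; case: (eO _ _ yz) => [[/chP[zo pz lz] Oz]|/chP[yo <- ly]].
    have [mz|zm] := ltnP m (lv z); last exact: alive_top.
    by rewrite alive_child// Oz pz.
  have [my|ym] := ltnP m (lv y); first exact: alive_par.
  by apply: alive_top; lia.
have inv y : reachable e x y -> alive T O m y.
  by move=> [p pp <-]; apply: along pp _; apply: alive_top; rewrite /m.
apply: (@sub_finite_set _ _ [set` level_ball (m + n)]); last exact: finite_seq.
move=> y /inv ay; suff : y \in level_ball (m + n) by [].
apply: mem_level_ball; rewrite leqNgt; apply/negP => yl.
pose k := (lv y - (m + n))%N.
have ly' : lv (iter k par y) = (m + n)%N by rewrite lv_iter_par /k; lia.
have ay' : alive T O m (iter k par y) by apply: alive_iter => //; rewrite /k; lia.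
have s1 := survival_alive R ly' ay'.
have := @level_sum_ub R _ _ _ T (survival T (1 : R) n) m o O (iter n par (iter k par y)).
rewrite s1 => H; move: Hn; rewrite ltNge => /negP; apply; apply: H.
- by move=> i; have /andP[] := survival_itv T n i O (lexx (1 : R)).
- by rewrite lv_iter_par ly' ?lv_root; lia.
- apply/eqP; rewrite (root_lv0 T) -iterD -iterD lv_iter_par; last by rewrite /k; lia.
  by rewrite /k; lia.
Qed.

Lemma unbounded_infinite (A : set V) :
  (forall n, exists2 y, A y & lv y = n) -> infinite_set A.
Proof.
move=> H /finite_seqP[s As].
have [y Ay ly] := H (\max_(z <- s) lv z).+1.
have : (lv y <= \max_(z <- s) lv z)%N by apply: leq_bigmax_seq => //; move: Ay; rewrite As.
by rewrite ly ltnn.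
Qed.

End Clusters.

(** * Almost sure behaviour of the disordered network *)

Section Percolation.
Context (R : realType) (V : choiceType) (o : V) (b : nat) (T : rtree o b).
Local Notation lv := (lv T).
Local Notation par := (par T).
Local Notation ch := (ch T).
Context (adj : rel V).
Hypothesis b_gt1 : (1 < b)%N.
Hypothesis adjE : forall x y, adj x y = (y \in ch x) || (x \in ch y).
Hypothesis gdistE : forall x, gdist adj x o = lv x.
Context (dW : measure_display) (W : measurableType dW) (P : probability W R).
Context (U : {fset V} -> {RV P >-> R}).
Hypothesis iidU : iid_uniform adj U.
Local Notation open_at := (open_at T U).
Local Notation uedge := (uedge T).
Local Notation net l1 l2 q w :=
  (disordered U (Clambda adj o l1) (Clambda adj o l2) q w).

Lemma b_gt0 : (0 < b)%N. Proof. exact: ltnW. Qed.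

Lemma edge_level_uedge i : i != o -> edge_level adj o (uedge i) = (lv i).-1.
Proof.
move=> io; rewrite /edge_level.
set A := (X in nat_min X).
have Ap : A (lv (par i)).
  by exists (par i); rewrite ?gdistE// !inE eqxx.
have [[x xe <-] lmin] := nat_minP (ex_intro _ _ Ap).
have := lmin _ Ap; have := lv_par T io.
move: xe; rewrite !inE gdistE => /orP[/eqP ->|/eqP ->]; lia.
Qed.

Lemma edge_cond_net l1 l2 q w :
  edge_cond T (net l1 l2 q w) = level_cond T l1 l2 (open_at q w).
Proof.
apply/funext => i; rewrite /edge_cond /level_cond; case: eqVneq => [->|io].
  by rewrite lv_root expr0 invr1.
rewrite /disordered /Clambda -/(uedge i) edge_level_uedge// /open_at.
by case: ifP.
Qed.

Lemma open_at_mono p q w i : q <= p -> open_at q w i -> open_at p w i.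
Proof. by move=> qp /le_trans; apply. Qed.

Lemma recurrent_of_thin l1 l2 q w : 0 < l1 -> b%:R <= l2 ->
  thin_below T l1 (open_at q w) -> recurrent adj (net l1 l2 q w).
Proof.
move=> l10 l2b thin; apply: (recurrent_of_cutoffs b_gt0 adjE (T := T)).
  by move=> i; rewrite edge_cond_net; apply: level_cond_gt0 => //; exact: b_gt0.
by rewrite edge_cond_net; apply: thin_cutoff => //; exact: b_gt0.
Qed.

Lemma transient_of_survival_lim l1 l2 lam q w : 0 < l1 -> 0 < l2 -> 1 <= lam ->
  l1 < lam ->
  0 < survival_lim T lam (open_at q w) o -> ~ recurrent adj (net l1 l2 q w).
Proof.
move=> l10 l20 lam1 l1lam th.
have ec0 i : 0 < edge_cond T (net l1 l2 q w) i.
  by rewrite edge_cond_net /level_cond invr_gt0 exprn_gt0//; case: ifP.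
apply: (@not_recurrent_of_subharmonic _ _ _ _ T adj _ b_gt0 adjE ec0
  (escape T l1 lam (open_at q w))).
- by move=> y; exact: escape_itv.
- exact: escape_root.
- by move=> y yo; rewrite edge_cond_net; exact: escape_subharmonic.
- by rewrite edge_cond_net; exact: outflow_root_gt0.
- exists dW, W, P, (walk T adj (net l1 l2 q w) U o).
  exact: (walk_is_random_walk b_gt0 adjE ec0 iidU).
Qed.

Lemma thin_below_mono (l1 : R) (O O' : V -> bool) : 0 < l1 ->
  (forall i, O i -> O' i) ->
  thin_below T l1 O' -> thin_below T l1 O.
Proof.
move=> l10 OO' thin m e m0 e0; have [L L0 HL] := thin m e m0 e0.
exists L => //; apply: le_trans HL; apply: level_sum_le => i.
by apply: path_weight_mono => //; exact: ltW.
Qed.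

(** Below every level, open paths have bounded length. *)
Definition extinct (O : V -> bool) := forall m, (0 < m)%N ->
  exists n, level_sum T (survival T (1 : R) n) m o O < 1.

Lemma thin_of_extinct (l1 : R) O : extinct O -> thin_below T l1 O.
Proof.
move=> ext m e m0 e0; have [n Hn] := ext m m0.
exists n.+1 => //; rewrite level_sum_extinct ?(ltW e0)//.
apply: le_lt_trans Hn; apply: level_sum_le => i.
exact: survivalS_le (lexx (1 : R)).
Qed.

Section Almost.
Variable p : R.
Hypothesis pI : 0 <= p <= 1.

(** The event that all F n stay above e lies in each event that F n does, whose
probability is at most the mean divided by e. *)
Lemma ae_ex_small (s : nat -> seq V) (F : nat -> (V -> bool) -> R) e :
  0 < e -> (forall n, uniq (s n)) -> (forall n, o \notin s n) ->
  (forall n, depends (s n) (F n)) -> (forall n O, 0 <= F n O) ->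
  (forall d, 0 < d -> exists n, bit_expect p (s n) (F n) <= d) ->
  {ae P, forall w, exists n, F n (open_at p w) < e}.
Proof.
move=> e0 us os dF F0 small.
pose N := \bigcap_n [set w | e <= F n (open_at p w)].
have mF n : measurable [set w | e <= F n (open_at p w)].
  exact: (measurable_bits T U p (@depends_le _ _ _ _ (dF n) e)).
have mN : measurable N by exact: bigcapT_measurable.
exists N; split => //; last first.
  move=> w /= H n _ /=; rewrite leNgt; apply/negP => Fe; apply: H; by exists n.
rewrite prE//; congr EFin; apply/eqP; rewrite eq_le pr_ge0 andbT.
apply/ler_addgt0Pl => d d0; rewrite addr0.
have [n Hn] := small (e * d) (mulr_gt0 e0 d0).
apply: le_trans (_ : pr P [set w | e <= F n (open_at p w)] <= _).
  by apply: pr_le => // w; apply.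
apply: le_trans (markov_bits adjE iidU pI (us n) (os n) (dF n) e0 (F0 n)) _.
by rewrite ler_pdivrMl.
Qed.

(** The first moment of the weight of open paths of length L is (b p / l1)^L up to a
factor that depends on the level only. *)
Lemma ae_thin l1 : 0 < l1 -> b%:R * p < l1 ->
  {ae P, forall w, thin_below T l1 (open_at p w)}.
Proof.
move=> l10 bp; have /andP[p0 _] := pI.
pose x := b%:R * (p / l1).
have x0 : 0 <= x by rewrite mulr_ge0// divr_ge0// ltW.
have x1 : x < 1 by rewrite /x mulrA ltr_pdivrMr// mul1r.
have small m d : 0 < d -> exists n, b.+1%:R ^+ m * x ^+ n.+1 <= d.
  move=> d0; have B0 : 0 < b.+1%:R ^+ m :> R by rewrite exprn_gt0.
  have : x ^+ n @[n --> \oo] --> 0 by apply: cvg_expr; rewrite ger0_norm.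
  move=> /cvgr_lt /(_ _ (divr_gt0 d0 B0))[n _ /(_ n.+1 (leqnSn n))] H.
  by exists n; rewrite mulrC -ler_pdivlMr// ltW.
have H : {ae P, forall w, forall m k, exists n,
    level_sum T (path_weight T l1 n.+1) m.+1 o (open_at p w) < k.+1%:R^-1}.
  apply: ae_foralln => m; apply: ae_foralln => k.
  apply: (@ae_ex_small (fun n => desc T (m.+1 + n.+1) o)
     (fun n => level_sum T (path_weight T l1 n.+1) m.+1 o)).
  - by rewrite invr_gt0.
  - by move=> n; exact: desc_uniq.
  - by move=> n; exact: desc_nroot.
  - by move=> n; apply: depends_level_sum => i; exact: depends_path_weight.
  - by move=> n O; apply: level_sum_ge0 => i; apply: path_weight_ge0; exact: ltW.
  - move=> d d0; have [n Hn] := small m.+1 d d0; exists n.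
    apply: le_trans Hn; apply: bit_expect_level_sum => //.
    + by rewrite exprn_ge0.
    + by move=> i; exact: depends_path_weight.
    + by move=> i io; exact: bit_expect_path_weight.
apply: filterS H => w H m e m0 e0.
(* Only the countably many thresholds 1/(k+1) were treated almost surely. *)
have [n Hn] := H m.-1 (Num.truncn e^-1).
exists n.+1 => //; rewrite prednK// in Hn; apply: le_trans (ltW Hn) _.
rewrite invf_ple ?posrE//; apply: ltW; exact: Num.Theory.truncnS_gt.
Qed.

(** The survival probabilities have mean at least 2 e for all depths, hence are at
least e with probability at least e, and these events decrease with the depth.
This produces one configuration in any given almost sure event. *)
Lemma survive_prob lam (Q : set W) : 1 <= lam -> lam < b%:R * p ->
  {ae P, forall w, Q w} ->
  exists s w, [/\ 0 < s, Q w & forall n, s <= survival T lam n o (open_at p w)].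
Proof.
move=> lam1 lamp aeQ; have /andP[p0 p1] := pI.
have lam0 : 0 < lam := lt_le_trans ltr01 lam1.
pose r := p / lam.
have rI : 0 <= r <= 1.
  by rewrite divr_ge0 ?(ltW lam0)//= ler_pdivrMr// mul1r (le_trans p1).
have br : 1 < b%:R * r by rewrite /r mulrA ltr_pdivlMr// mul1r.
have r0 : 0 < r.
  rewrite lt_neqAle eq_sym (andP rI).1 andbT; apply/eqP => r0.
  by rewrite r0 mulr0 ltr10 in br.
have [s s0 Hs] := supercritical_iter rI br.
have sE n : r * s <= bit_expect p (desc T n o) (survival T lam n o).
  case: n => [|n].
    rewrite /=; apply: mulr_ile1; [exact: ltW|exact: ltW|by case/andP: rI|].
    exact: (Hs 0%N).
  rewrite (@bit_expect_survival_step _ _ _ _ T p lam n o (iter n (survival_map b r) 1)); last first.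
    by move=> i /chP[io _ _]; exact: bit_expect_survival.
  rewrite eqxx -/r add1n.
  have /andP[i0 i1] := @iter_survival_map_itv R b r n rI.
  set t := iter n _ _ in i0 i1 *.
  have st : s <= t by exact: Hs.
  have rt0 : 0 <= r * t by rewrite mulr_ge0// ltW.
  have rt1 : r * t <= 1 by rewrite mulr_ile1//; case/andP: rI.
  rewrite exprS; have : (1 - r * t) ^+ b <= 1 by rewrite exprn_ile1//; lra.
  have : 0 <= (1 - r * t) ^+ b by rewrite exprn_ge0//; lra.
  have : r * s <= r * t by rewrite ler_wpM2l// ltW.
  nra.
pose e := r * s / 2.
have e0 : 0 < e by rewrite divr_gt0// mulr_gt0.
pose F n := [set w | e <= survival T lam n o (open_at p w)].
have mF n : measurable (F n).
  exact: (measurable_bits T U p (@depends_le _ _ _ _ (@depends_survival _ _ _ _ T lam n o) e)).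
have eF n : e <= pr P (F n).
  apply: (reverse_markov_bits adjE iidU pI (desc_uniq T n o) (desc_nroot T n o)).
  - exact: depends_survival.
  - by move=> O; have /andP[] := survival_itv T n o O lam1.
  - by rewrite /e mulrC divfK//; exact: sE.
  - exact: ltW.
have decF n : F n.+1 `<=` F n.
  by move=> w; rewrite /F /= => /le_trans; apply; exact: survivalS_le.
have [w Fw Qw] := ae_exists aeQ (bigcapT_measurable mF)
  (lt_le_trans e0 (pr_bigcap_ge mF decF eF)).
by exists e, w; split=> // n; exact: (Fw n I).
Qed.

End Almost.

(** The first moment of the number of survivors is governed by [critical_iter]. *)
Lemma ae_extinct : {ae P, forall w, extinct (open_at b%:R^-1 w)}.
Proof.
have b0 : 0 < b%:R :> R by rewrite ltr0n b_gt0.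
pose p : R := b%:R^-1.
have pI : 0 <= p <= 1.
  by rewrite /p invr_ge0 ler0n invf_le1// ler1n b_gt0.
have H : {ae P, forall w, forall m, exists n,
    level_sum T (survival T (1 : R) n) m.+1 o (open_at b%:R^-1 w) < 1}.
  apply: ae_foralln => m.
  apply: (@ae_ex_small _ pI (fun n => desc T (m.+1 + n) o)
     (fun n => level_sum T (survival T 1 n) m.+1 o)) => //.
  - by move=> n; exact: desc_uniq.
  - by move=> n; exact: desc_nroot.
  - by move=> n; apply: depends_level_sum => i; exact: depends_survival.
  - by move=> n O; apply: level_sum_ge0 => i; have /andP[] := survival_itv T n i O (lexx (1 : R)).
  - move=> d d0; have B0 : 0 < b.+1%:R ^+ m.+1 :> R by rewrite exprn_gt0.
    have [n Hn] := critical_iter b_gt1 (divr_gt0 d0 B0); exists n.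
    apply: le_trans (_ : b.+1%:R ^+ m.+1 * iter n (survival_map b b%:R^-1) 1 <= _).
      apply: bit_expect_level_sum => //.
      + by have /andP[] := iter_survival_map_itv b n pI.
      + by move=> i; exact: depends_survival.
      + by move=> i io; rewrite bit_expect_survival// divr1.
    by rewrite mulrC -ler_pdivlMr// ltW.
apply: filterS H => w H m m0; rewrite -(prednK m0); exact: H.
Qed.

Lemma no_infinite_cluster p w : p <= b%:R^-1 -> extinct (open_at b%:R^-1 w) ->
  ~ has_infinite_cluster adj U p w.
Proof.
move=> pb ext [x]; apply; apply: (@finite_extinct_cluster _ _ _ T R _ (open_at b%:R^-1 w) x _ ext) => y z /=.
rewrite /open_adj /= adjE => /andP[/orP[zy|yz] Ule]; last by right.
left; split=> //; have [_ pz _] := chP zy.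
by rewrite /open_at /uedge pz (le_trans Ule).
Qed.

Lemma infinite_cluster_of_survival p w s : 0 < s ->
  (forall n, s <= survival T (1 : R) n o (open_at p w)) -> has_infinite_cluster adj U p w.
Proof.
move=> s0 Hs; exists o; apply: (unbounded_infinite (T := T)) => n.
have [||y ry ly] := @survival_reach _ _ _ T R 1 (open_adj adj U p w) (open_at p w) n o.
- by move=> i io Oi; rewrite /open_adj /= adjE mem_ch io eqxx.
- by rewrite gt_eqF// (lt_le_trans s0).
by exists y => //; rewrite ly lv_root.
Qed.

Lemma sup_threshold (A : set R) t : 0 < t ->
  (forall p, 0 <= p -> p < t -> A p) -> (forall p, A p -> p <= t) -> sup A = t.
Proof.
move=> t0 lowA upA; apply/eqP; rewrite eq_le; apply/andP; split.
  by apply: ge_sup => //; exists 0; exact: lowA.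
have hA : has_sup A by split; [exists 0; exact: lowA|exists t].
rewrite leNgt; apply/negP => st.
have s0 : 0 <= sup A by apply: sup_upper_bound => //; exact: lowA.
have [m1 m2] := midf_lt st.
have := sup_upper_bound hA (lowA _ (le_trans s0 (ltW m1)) m2).
by rewrite leNgt m1.
Qed.

Lemma p_cE : p_c adj U = b%:R^-1.
Proof.
have b0 : 0 < b%:R :> R by rewrite ltr0n b_gt0.
have b1 : b%:R^-1 <= 1 :> R by rewrite invf_le1// ler1n b_gt0.
apply: sup_threshold; first by rewrite invr_gt0.
  move=> p p0 pb; split; first by rewrite p0 (le_trans (ltW pb)).
  apply: filterS ae_extinct => w; apply: no_infinite_cluster; exact: ltW.
move=> p [pI aeN]; rewrite leNgt; apply/negP => bp.
have bp1 : 1 < b%:R * p by rewrite -ltr_pdivrMl// mulr1.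
have [s [w [s0 Nw Hs]]] := survive_prob pI (lexx (1 : R)) bp1 aeN.
by apply: Nw; exact: infinite_cluster_of_survival Hs.
Qed.

(** Below the threshold, thinness comes from extinction if l1 <= 1 and from the
first moment if l1 > 1; it passes from p to all q < p by monotonicity. Above the
threshold there is room for q and lam with max(l1, 1) < lam < b q. *)
Lemma p_c_starE l1 l2 : 0 < l1 -> l1 < b%:R -> b%:R <= l2 ->
  p_c_star adj U (Clambda adj o l1) (Clambda adj o l2) = Num.max l1 1 / b%:R.
Proof.
move=> l10 l1b l2b.
have b0 : 0 < b%:R :> R by rewrite ltr0n b_gt0.
have b1 : 1 < b%:R :> R by rewrite ltr1n.
have m1 : 1 <= Num.max l1 1 by rewrite le_max lexx orbT.
have ml1 : l1 <= Num.max l1 1 by rewrite le_max lexx.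
have mb : Num.max l1 1 < b%:R by rewrite gt_max l1b b1.
apply: sup_threshold; first by rewrite divr_gt0// (lt_le_trans ltr01).
  move=> p p0 pt.
  have p1 : p <= 1.
    by apply: ltW; apply: lt_trans pt _; rewrite ltr_pdivrMr// mul1r.
  have pI : 0 <= p <= 1 by rewrite p0.
  split=> //; move: pt; rewrite maxEle; case: (lerP l1 1) => l11 pt.
    apply: filterS ae_extinct => w ext q /andP[q0 qp].
    apply: recurrent_of_thin => //.
    apply: (thin_below_mono l10 _ (thin_of_extinct l1 ext)) => i.
    by apply: open_at_mono; rewrite -[leRHS]mul1r; apply: ltW; exact: lt_trans pt.
  have bp : b%:R * p < l1 by rewrite mulrC -ltr_pdivlMr.
  apply: filterS (ae_thin pI l10 bp) => w thin q /andP[q0 qp].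
  apply: recurrent_of_thin => //; apply: thin_below_mono thin => // i.
  by apply: open_at_mono; exact: ltW.
move=> p [/andP[p0 p1] aeR]; rewrite leNgt; apply/negP => tp.
have [tq qp] := midf_lt tp; set q := (_ / 2) in tq qp.
have bq : Num.max l1 1 < b%:R * q by rewrite mulrC -ltr_pdivrMr.
have [mlam lamq] := midf_lt bq; set lam := (_ / 2) in mlam lamq.
have q0 : 0 <= q.
  apply: le_trans (ltW tq); apply: divr_ge0; [exact: le_trans ler01 m1|exact: ltW].
have qI : 0 <= q <= 1 by rewrite q0 (le_trans (ltW qp)).
have [s [w [s0 Rw Hs]]] := survive_prob qI (le_trans m1 (ltW mlam)) lamq aeR.
have := Rw q; rewrite q0 qp => /(_ isT); apply: (@transient_of_survival_lim l1 l2 lam) => //.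
- exact: lt_le_trans b0 l2b.
- exact: le_trans m1 (ltW mlam).
- exact: le_lt_trans ml1 mlam.
- apply: lt_le_trans s0 _; apply: survival_lim_ge => //; exact: le_trans m1 (ltW mlam).
Qed.

Lemma critical_recurrent l1 l2 : 0 < l1 -> b%:R <= l2 ->
  {ae P, forall w, recurrent adj (net l1 l2 b%:R^-1 w)}.
Proof.
move=> l10 l2b; apply: filterS ae_extinct => w ext.
by apply: recurrent_of_thin => //; exact: thin_of_extinct.
Qed.

End Percolation.

Theorem theorem2p6 (R : realType) (d : nat) (V : choiceType) (adj : rel V)
    (o : V) (dW : measure_display) (W : measurableType dW)
    (P : probability W R) (U : {fset V} -> {RV P >-> R}) :
  (3 <= d)%N ->
  is_regular_tree d adj ->
  iid_uniform adj U ->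
  [/\ p_c adj U = 1 / (d%:R - 1),
      forall lambda1 lambda2 : R,
        0 < lambda1 -> lambda1 < d%:R - 1 -> d%:R - 1 <= lambda2 ->
        p_c_star adj U (Clambda adj o lambda1) (Clambda adj o lambda2)
          = Num.max lambda1 1 / (d%:R - 1) /\
        p_c_star adj U (Clambda adj o lambda1) (Clambda adj o lambda2)
          = Num.max lambda1 1 * p_c adj U
    & forall lambda1 lambda2 : R,
        0 < lambda1 -> lambda1 <= 1 -> 1 < d%:R - 1 :> R ->
        d%:R - 1 < lambda2 ->
        {ae P, forall w, recurrent adj
           (disordered U (Clambda adj o lambda1) (Clambda adj o lambda2)
              (1 / (d%:R - 1)) w)}].
Proof.
move=> d3 [[sym irr conn acyc] reg] iidU.
have d0 : (0 < d)%N by lia.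
have [T [adjE gdistE]] := rtree_of_regular o sym irr conn acyc d0 reg.
have b1 : (1 < d.-1)%N by lia.
have -> : d%:R - 1 = d.-1%:R :> R by rewrite -{1}(prednK d0) -natr1 addrK.
have pcE : p_c adj U = d.-1%:R^-1 := p_cE b1 adjE iidU.
rewrite pcE div1r; split=> // l1 l2 l10 l1b.
- by move=> l2b; rewrite (p_c_starE b1 adjE gdistE iidU l10 l1b l2b).
- by move=> _ l2b; exact: (critical_recurrent b1 adjE gdistE iidU l10 (ltW l2b)).
Qed.
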